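(* Let $M$ be a Riemannian manifold, let $f\in C^1(M)$, and let $K\subset M$ be an uncountable expanding set of $f$. Then $K$ has homoclinic orbits associated to periodic repellors; that is, there exist a periodic repellor $\gamma\subset K$ of $f$ and an orbit $\{x_n\}_{n\in\mathbb{Z}}\subset K$ of $f$ that is homoclinic to $\gamma$. If in addition $K$ is transitive, then for every periodic orbit $\gamma\subset K$ of $f$, $$K=\overline{\Big(\bigcup_{n\geq 0}f^{-n}(\gamma)\Big)\cap W^u_f(\gamma)\cap K}.$$ In particular, $K$ is contained in the homoclinic class $H_\gamma(f)$ of $\gamma$.
   Context: $C^1(M)$ denotes the set of $C^1$ maps $f:M\to M$ (not necessarily invertible). A compact set $K\subset M$ is an expanding set of $f$ if: (1) there exist constants $C>0$ and $\lambda>1$ such that $\|Df^n_x(v)\|\geq C\lambda^n\|v\|$ for every $x\in K$, every vector $v$ tangent to $M$ at $x$ and every $n>0$; and (2) $K$ is isolated: there exists a neighborhood $U$ of $K$ such that $K=\bigcap_{n\geq 0}f^{-n}(U)$. The set $K$ is transitive if there is a point of $K$ whose future orbit is dense in $K$. A periodic point $x$ of period $k$ is a repellor if $Df^k_x$ is a linear expanding map (all its eigenvalues have modulus greater than $1$); the periodic orbit $\gamma=\{f^j(x):0\leq j\leq k-1\}$ is then also called a (periodic) repellor. An orbit of $f$ is a bi-infinite sequence $\{x_n\}_{n\in\mathbb{Z}}$ with $f(x_{n+1})=x_n$ for all $n\in\mathbb{Z}$. It is homoclinic to a repellor $\gamma$ (a homoclinic orbit associated to $\gamma$) if $x_n\to\gamma$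 as $n\to\pm\infty$ and $\{x_n\}$ is not contained in $\gamma$. A preorbit of a point $x_0$ is a sequence $\{x_n\}_{n\geq 0}$ with $f(x_{n+1})=x_n$ for all $n\ge 0$. The unstable set $W^u_f(\gamma)$ of a repellor $\gamma$ is the set of points of $M$ having a preorbit that converges to $\gamma$. The homoclinic class of $\gamma$ is $H_\gamma(f)=\overline{\big(\bigcup_{n\geq 0}f^{-n}(\gamma)\big)\cap W^u_f(\gamma)}$. *)

(* Defs.v *)
From HB Require Import structures.
From mathcomp Require Import all_boot all_order all_algebra.
From mathcomp Require Import all_classical all_reals all_analysis.
From mathcomp Require Import complex.

Set Implicit Arguments.
Unset Strict Implicit.
Unset Printing Implicit Defensive.

Import Order.TTheory GRing.Theory Num.Theory.
Import numFieldNormedType.Exports.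

Local Open Scope classical_set_scope.
Local Open Scope ring_scope.

(* F is C^k at the points of the open set U; the values of F outside U are
   irrelevant.  In finite dimension the derivative is C^k as soon as each
   directional derivative is. *)
Fixpoint Ck (R : realType) (n : nat) (W : normedModType R) (k : nat)
    (U : set 'rV[R]_n) (F : 'rV[R]_n -> W) {struct k} : Prop :=
  match k with
  | 0%N => {in U, continuous F}
  | k'.+1 => (forall y, U y -> differentiable F y) /\
             (forall v : 'rV[R]_n, Ck k' U ('D_v F))
  end.

Definition smooth (R : realType) (n : nat) (W : normedModType R)
    (U : set 'rV[R]_n) (F : 'rV[R]_n -> W) : Prop :=
  forall k : nat, Ck k U F.

(* A homeomorphism from chart_dom onto an open subset of R^n, given by total
   functions whose values are meaningful only on chart_dom and on its image. *)
Record chart (R : realType) (n : nat) (M : topologicalType) := Chart {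
  chart_dom : set M;
  chart_fun :> M -> 'rV[R]_n;
  chart_inv : 'rV[R]_n -> M;
  chart_dom_open : open chart_dom;
  chart_img_open : open (chart_fun @` chart_dom);
  chart_funK : forall x, chart_dom x -> chart_inv (chart_fun x) = x;
  chart_fun_continuous : {in chart_dom, continuous chart_fun};
  chart_inv_continuous : {in chart_fun @` chart_dom, continuous chart_inv}
}.

(* chart_at selects an atlas chart around each point; it serves to represent
   tangent vectors by coordinates, see [tangent]. *)
Record smoothManifold (R : realType) (n : nat) := SmoothManifold {
  carrier :> topologicalType;
  manifold_hausdorff : hausdorff_space carrier;
  manifold_second_countable : @second_countable carrier;
  atlas : set (chart R n carrier);
  atlas_smooth : forall c c', atlas c -> atlas c' ->
    smooth (c @` (chart_dom c `&` chart_dom c')) (c' \o chart_inv c);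
  chart_at : carrier -> chart R n carrier;
  chart_at_atlas : forall x, atlas (chart_at x);
  chart_at_dom : forall x, chart_dom (chart_at x) x
}.

(* The tangent space at x: a vector is given by its row of coordinates in the
   chart chart_at x. *)
Definition tangent (R : realType) (n : nat) (M : smoothManifold R n) (x : M)
  : Type := 'rV[R]_n.

(* metric x is the Gram matrix of the inner product on the tangent space at x.
   If J is the Jacobian (acting on row vectors) at y of the change of
   coordinates from a chart c to chart_at x, where y = c x, then
   J *m metric x *m J^T is the Gram matrix in the coordinates of c. *)
Record riemannianManifold (R : realType) (n : nat) := RiemannianManifold {
  underlying :> smoothManifold R n;
  metric : underlying -> 'M[R]_n;
  metric_sym : forall x, (metric x)^T = metric x;
  metric_pos : forall x (v : 'rV[R]_n), v != 0 ->
    0 < (v *m metric x *m v^T) 0 0;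
  metric_smooth : forall c, atlas c ->
    smooth (c @` chart_dom c)
      (fun y => let x := chart_inv c y in
                let J := jacobian (chart_at x \o chart_inv c) y in
                J *m metric x *m J^T)
}.

Definition tangent_norm (R : realType) (n : nat) (M : riemannianManifold R n)
    (x : M) (v : tangent x) : R :=
  Num.sqrt ((v *m metric x *m v^T) 0 0).

Definition C1_map (R : realType) (n : nat) (M : smoothManifold R n)
    (f : M -> M) : Prop :=
  continuous f /\
  forall c c' : chart R n M, atlas c -> atlas c' ->
    Ck 1 (c @` (chart_dom c `&` f @^-1` chart_dom c'))
      (c' \o f \o chart_inv c).

(* The matrix of D f_x from the tangent space at x to that at f x; matrices act
   on rows on the right.  When f x = x, source and target coordinates agree. *)
Definition tangent_map_mx (R : realType) (n : nat) (M : smoothManifold R n)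
    (f : M -> M) (x : M) : 'M[R]_n :=
  jacobian (chart_at (f x) \o f \o chart_inv (chart_at x)) (chart_at x x).

Definition tangent_map (R : realType) (n : nat) (M : smoothManifold R n)
    (f : M -> M) (x : M) (v : tangent x) : tangent (f x) :=
  v *m tangent_map_mx f x.

Definition expanding_set (R : realType) (n : nat) (M : riemannianManifold R n)
    (f : M -> M) (K : set M) : Prop :=
  [/\ compact K,
      exists C lambda : R, [/\ 0 < C, 1 < lambda &
        forall (x : M) (v : tangent x) (m : nat), K x -> (0 < m)%N ->
          C * lambda ^+ m * tangent_norm v
            <= tangent_norm (tangent_map (iter m f) v)] &
      exists2 U : set M, K `<=` U° &
        K = \bigcap_(m in [set: nat]) (iter m f @^-1` U)].

Definition future_orbit (T : Type) (f : T -> T) (x : T) : set T :=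
  [set iter m f x | m in [set: nat]].

Definition transitive_set (T : topologicalType) (f : T -> T) (K : set T)
  : Prop :=
  exists2 x, K x & K `<=` closure (future_orbit f x `&` K).

(* k is a period of x, not necessarily the least one; whether
   the eigenvalues of D f^k_x are of modulus > 1 does not depend on k. *)
Definition periodic_point (T : Type) (f : T -> T) (k : nat) (x : T) : Prop :=
  (0 < k)%N /\ iter k f x = x.

Definition periodic_orbit (T : Type) (f : T -> T) (gamma : set T) : Prop :=
  exists k x, periodic_point f k x /\
    gamma = [set iter j f x | j in [set j | (j < k)%N]].

(* Eigenvalues are the complex ones. *)
Definition linear_expanding (R : realType) (n : nat) (A : 'M[R]_n) : Prop :=
  forall a : R[i], eigenvalue (map_mx (real_complex R) A) a -> 1 < `|a|.

Definition periodic_repellor (R : realType) (n : nat) (M : smoothManifold R n)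
    (f : M -> M) (gamma : set M) : Prop :=
  exists k x, [/\ periodic_point f k x,
    linear_expanding (tangent_map_mx (iter k f) x) &
    gamma = [set iter j f x | j in [set j | (j < k)%N]]].

(* The sequence u enters every neighborhood of the set A; for compact A (such as
   a periodic orbit) this is convergence to 0 of the distance to A. *)
Definition converges_to_set (T : topologicalType) (u : nat -> T) (A : set T)
  : Prop :=
  forall U : set T, set_nbhs A U -> \forall m \near \oo, U (u m).

(* With this indexing the future of x 0 is x (-1), x (-2), etc. *)
Definition full_orbit (T : Type) (f : T -> T) (x : int -> T) : Prop :=
  forall m : int, f (x (m + 1)) = x m.

Definition homoclinic_orbit (T : topologicalType) (f : T -> T) (gamma : set T)
    (x : int -> T) : Prop :=
  [/\ full_orbit f x,
      converges_to_set (fun m : nat => x (m%:Z)) gamma,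
      converges_to_set (fun m : nat => x (- m%:Z)) gamma &
      ~ (range x `<=` gamma)].

Definition preorbit (T : Type) (f : T -> T) (x0 : T) (x : nat -> T) : Prop :=
  x 0%N = x0 /\ forall m, f (x m.+1) = x m.

Definition unstable_set (T : topologicalType) (f : T -> T) (gamma : set T)
  : set T :=
  [set x0 | exists2 x, preorbit f x0 x & converges_to_set x gamma].

Definition iterated_preimages (T : Type) (f : T -> T) (gamma : set T) : set T :=
  \bigcup_(m in [set: nat]) (iter m f @^-1` gamma).

Definition homoclinic_class (T : topologicalType) (f : T -> T) (gamma : set T)
  : set T :=
  closure (iterated_preimages f gamma `&` unstable_set f gamma).

(* Main.v *)
Require Import Defs.
From HB Require Import structures.
From mathcomp Require Import all_boot all_order all_algebra.
From mathcomp Require Import all_classical all_reals all_analysis.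
From mathcomp Require Import complex.
From mathcomp Require Import zify ring lra.

(** The differential geometry only serves to establish three facts about the
    restriction of [f] to [K], after which the argument is topological.
    - [f] maps [K] into itself, because [K] is the set of points whose whole
      future stays in the isolating neighborhood [U].
    - The restriction is open: [Df] is invertible on [K], so [f] is locally onto
      at the points of [K] ([strict_diff_open], [expanding_open]), and a point
      of [U] whose image is in [K] is in [K].
    - The restriction is expansive ([exists_expansive_nbhs]): in finitely many
      charts around [K], a high iterate of [f] at least doubles the coordinate
      distance of nearby points, since [C^1] maps are strictly differentiable
      ([C1_strict_diff]) and the Riemannian norm is locally comparable with the
      coordinate norm ([exists_controlled_nbhs]).

    Let now [f] be an open expansive map of a compact Hausdorff space, and [E] a
    closed symmetric expansive neighborhood of the diagonal.  The sets [bowen n]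
    of pairs that stay [E]-close for the times [0..n] replace the balls of an
    adapted metric.  They decrease to the diagonal, so by compactness they are
    a base of its neighborhoods ([bowen_nbhs_section]) and satisfy a triangle
    inequality up to a fixed shift of [n] ([bowen_triangle]).  Openness gives
    the inverse branches ([bowen_lift]): a point close to [iter M f x] lifts
    under [iter M f] to a point close to [x], and each backward step gains one
    unit of closeness.  Two consequences are the closing lemma
    ([closing_lemma]): a point that returns close to itself late enough is
    close to a periodic point; and the fact that a point close to a periodic point belongs
    to the unstable set of its orbit ([local_unstable]).

    Homoclinic orbits ([exists_homoclinic_point]).  Code the points by finitely
    many small pieces.  Every orbit visits some piece infinitely often, and
    [f] is finite-to-one, so when the space is uncountable there is a piece [a]
    containing uncountably many points that come back to [a] infinitely often.
    One of these, [z], yields a periodic point [p] near [a].  Another one, [y],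
    avoids the orbit of [p].  Lifting [p] back along the orbit of [y], from a
    late return to [a], gives a point [w] that is eventually mapped to [p], is
    so close to [y] that it is not in the orbit of [p], and is close to [p], so
    that it lies in its unstable set.

    Transitive case ([dense_orbit_homoclinic]).  A dense orbit visits every open
    set at arbitrarily late times, as otherwise the space would have an isolated
    point on that orbit and be finite.  Hence it passes close to [p], then close
    to a given [x], then close to [p] again, and lifting [p] back along this
    stretch gives a homoclinic point close to [x].

    Finally, periodic points of [K] are repellors ([periodic_repelling]): the
    real part of an eigenvector for an eigenvalue of modulus at most [1] would
    have bounded iterates under a linear map that expands all real vectors. *)

Set Implicit Arguments.
Unset Strict Implicit.
Unset Printing Implicit Defensive.

Import Order.TTheory GRing.Theory Num.Theory.
Import numFieldNormedType.Exports.

Local Open Scope classical_set_scope.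

(** * Compactness and finite covers *)

(** Limits of points taken in each [C n] outside [O] would lie in all the [C n] and
    outside the interior of [O].  Compactness is applied to the sets [bowen n] in this
    form: what holds near their intersection already holds on one of them. *)
Lemma nested_closed_compact (Y : topologicalType) (C : nat -> set Y)
    (O : set Y) : compact [set: Y] -> (forall n, closed (C n)) ->
  (forall m n, (m <= n)%N -> C n `<=` C m) ->
  (forall y, (forall n, C n y) -> nbhs y O) -> exists n, C n `<=` O.
Proof.
move=> cY clC decC capC; apply: contrapT => /forallNP noN.
have /choice [u uP] : forall n, exists y, C n y /\ ~ O y.
  by move=> n; have /existsNP[y /not_implyP ?] := noN n; exists y.
have [y [_ cly]] := cY (u @ \oo) _ filterT.
have Cy n : C n y.
  apply: (clC n) => B /cly clB.
  have Cn : (u @ \oo) (C n).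
    by exists n => //= k /= nk; apply: (decC n k nk); exact: (uP k).1.
  by have [z [Cz Bz]] := clB _ Cn; exists z.
have nO : (u @ \oo) (~` O) by exists 0%N => //= k _; exact: (uP k).2.
by have [z []] := cly _ _ nO (capC y Cy).
Qed.

(** The finite sequences, filtered by inclusion, serve as the index filter of the
    near-covering form of compactness. *)
Lemma compact_finite_nbhs_cover (X : topologicalType) (K : set X)
    (N : X -> set X) : compact K -> (forall x, nbhs x (N x)) ->
  exists s : seq X, forall y, K y -> exists2 x, x \in s & N x y.
Proof.
move=> /compact_near_coveringP cK nN.
pose F := filter_from [set: seq X] (fun s0 => [set s : seq X | {subset s0 <= s}]).
have FF : ProperFilter F.
  apply: filter_from_proper => [|s _]; last by exists s => /=.
  apply: filter_from_filter; first by exists [::].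
  move=> s t _ _; exists (s ++ t) => //= r str.
  by split => x xs; apply: str; rewrite mem_cat xs ?orbT.
have /= cov : \forall s \near F, K `<=` (fun y => exists2 x, x \in s & N x y).
  apply: (cK _ F (fun s y => exists2 x, x \in s & N x y)) => x _.
  exists (N x, [set s : seq X | {subset [:: x] <= s}]) => /=.
    by split; [exact: nN | exists [:: x]].
  by move=> [y s] /= [Ny xs]; exists x => //; apply: xs; rewrite inE.
by have [s sP] := @filter_ex _ F _ _ cov; exists s => y Ky; exact: sP.
Qed.

Lemma compact_prod (X Y : topologicalType) :
  compact [set: X] -> compact [set: Y] -> compact [set: X * Y].
Proof. by move=> cX cY; rewrite -setXTT; exact: compact_setX. Qed.

Lemma seq_uniform_bound (I : eqType) (s : seq I) (Q : I -> nat -> Prop) :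
  (forall a k l, (k <= l)%N -> Q a k -> Q a l) ->
  (forall a, a \in s -> exists k, Q a k) ->
  exists k, forall a, a \in s -> Q a k.
Proof.
move=> monoQ; elim: s => [|a s IH] h; first by exists 0%N.
have [k kP] := h a (mem_head _ _).
have [|l lP] := IH; first by move=> b bs; apply: h; rewrite inE bs orbT.
exists (maxn k l) => b; rewrite inE => /orP[/eqP ->|/lP].
  by apply: monoQ kP; exact: leq_maxl.
by apply: monoQ; exact: leq_maxr.
Qed.

Lemma countable_inj (Y Z : Type) (A : set Y) (C : set Z) (h : Y -> Z) :
  {in A &, injective h} -> (forall y, A y -> C (h y)) -> countable C ->
  countable A.
Proof.
move=> injh hAC /countable_injP[g injg]; apply/countable_injP.
exists (g \o h) => x y; rewrite !inE => Ax Ay /= /injg e.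
by apply: injh; rewrite ?inE//; apply: e; rewrite inE; exact: hAC.
Qed.

(** A finite union of squares of closed neighborhoods is closed and symmetric.
    Closedness is what makes the sets [bowen n] closed, hence fit for compactness
    arguments. *)
Lemma exists_closed_symmetric_nbhs (X : topologicalType) (W : set (X * X)) :
  hausdorff_space X -> compact [set: X] -> (forall x : X, nbhs (x, x) W) ->
  exists E : set (X * X), [/\ closed E, forall x : X, nbhs (x, x) E,
    forall x y, E (x, y) -> E (y, x) & E `<=` W].
Proof.
move=> hX cX nW.
have /choice[N NP] (x : X) : exists N : set X,
    [/\ closed N, nbhs x N & forall y z, N y -> N z -> W (y, z)].
  have [[A B] /= [nA nB] AB] := nW x.
  have [D nD DAB] := compact_regular hX cX filterT (filterI nA nB).
  exists (closure D); split; first exact: closed_closure.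
    by apply: filterS nD; exact: subset_closure.
  by move=> y z /DAB[Ay _] /DAB[_ Bz]; exact: (AB (y, z)).
have nN x : nbhs x ((N x)°) by apply: nbhs_interior; have [] := NP x.
have [s sP] := compact_finite_nbhs_cover cX nN.
exists [set p | exists2 a, a \in s & N a p.1 /\ N a p.2]; split.
- elim: s {sP} => [|a s IH].
    rewrite (_ : mkset _ = set0); first exact: closed0.
    by apply/seteqP; split=> // p [].
  rewrite (_ : mkset _ = (N a `*` N a) `|`
      [set p | exists2 a, a \in s & N a p.1 /\ N a p.2]).
    apply: closedU => //; have [clN _ _] := NP a.
    apply: (@closedI _ (fst @^-1` N a) (snd @^-1` N a)).
      by apply: preimage_closed clN => p _; exact: cvg_fst.
    by apply: preimage_closed clN => p _; exact: cvg_snd.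
  apply/seteqP; split=> p.
    by move=> [b]; rewrite inE => /orP[/eqP ->|bs] h; [left|right; exists b].
  by move=> [h|[b bs h]]; [exists a; rewrite ?mem_head|exists b; rewrite ?inE ?bs ?orbT].
- move=> x; have [a sa Nax] := sP x I.
  by exists (N a, N a) => // -[y z] [/= ? ?]; exists a.
- by move=> x y [a sa [? ?]]; exists a.
- by move=> [y z] [a sa [? ?]]; have [_ _] := NP a; exact.
Qed.

(** * Open expansive maps of a compact space *)

(** The dynamical (Bowen) entourages.  If [f] multiplied small distances by at least
    [l], their pairs would be at distance at most a constant times [l ^- n]; they
    measure closeness without any metric. *)
Definition bowen (X : Type) (f : X -> X) (E : set (X * X)) (n : nat) :
  set (X * X) :=
  [set p | forall j, (j <= n)%N -> E (iter j f p.1, iter j f p.2)].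

Section ExpansiveOpen.
Context (X : topologicalType) (f : X -> X) (E : set (X * X)).
Hypothesis cX : compact [set: X].
Hypothesis cf : continuous f.
Hypothesis open_f : forall x A, nbhs x A -> nbhs (f x) (f @` A).
Hypothesis clE : closed E.
Hypothesis nE : forall x : X, nbhs (x, x) E.
Hypothesis symE : forall x y, E (x, y) -> E (y, x).
Hypothesis expE : forall x y, (forall n, E (iter n f x, iter n f y)) -> x = y.

Local Notation B := (bowen f E).

Lemma continuous_iter n : continuous (iter n f).
Proof.
elim: n => [|n IH] x; first exact: cvg_id.
by rewrite /=; apply: (@continuous_comp _ _ _ (iter n f) f); [exact: IH|exact: cf].
Qed.

Lemma bowenS n x y : B n.+1 (x, y) <-> E (x, y) /\ B n (f x, f y).
Proof.
split=> [h|[h0 h] [|j] //= jn]; last by have := h j jn; rewrite /= -!iterSr.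
by split=> [|j jn]; [exact: (h 0%N)|rewrite /= -!iterSr; exact: h].
Qed.

Lemma bowen_le m n : (m <= n)%N -> B n `<=` B m.
Proof. by move=> mn p h j jm; apply: h; exact: leq_trans mn. Qed.

Lemma bowen_sym n x y : B n (x, y) -> B n (y, x).
Proof. by move=> h j jn; apply: symE; exact: h. Qed.

Lemma E_refl x : E (x, x).
Proof. exact: nbhs_singleton. Qed.

Lemma bowen_refl n x : B n (x, x).
Proof. by move=> j _; exact: E_refl. Qed.

Lemma bowen_iter n j x y :
  B (n + j) (x, y) -> B n (iter j f x, iter j f y).
Proof.
by move=> h i ni; rewrite /= -!iterD; apply: h; rewrite leq_add2r.
Qed.

Lemma bowen_eq x y : (forall n, B n (x, y)) -> x = y.
Proof. by move=> h; apply: expE => n; exact: (h n n). Qed.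

Lemma continuous_pair_map (Z : topologicalType) (g h : Z -> X) :
  continuous g -> continuous h -> continuous (fun z => (g z, h z)).
Proof. by move=> cg ch z; apply: cvg_pair; [exact: cg|exact: ch]. Qed.

Lemma closed_bowen n : closed (B n).
Proof.
have -> : B n = \bigcap_(j in [set j | (j <= n)%N])
   ((fun p => (iter j f p.1, iter j f p.2)) @^-1` E).
  by apply/seteqP; split=> p h j; exact: h.
apply: closed_bigI => j _; apply: preimage_closed clE => p _.
apply: continuous_pair_map => z.
  by apply: continuous_comp; [exact: cvg_fst|exact: continuous_iter].
by apply: continuous_comp; [exact: cvg_snd|exact: continuous_iter].
Qed.

Lemma nbhs_bowen n (x : X) : nbhs (x, x) (B n).
Proof.
elim: n x => [|n IH] x.
  by apply: filterS (nE x) => -[y z] Eyz j; rewrite leqn0 => /eqP ->.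
have ff : nbhs (x, x) ((fun p => (f p.1, f p.2)) @^-1` B n).
  suff : {for (x, x), continuous (fun p : X * X => (f p.1, f p.2))}.
    by apply; exact: IH.
  apply: continuous_pair_map => z; apply: continuous_comp => //; try exact: cf.
    exact: cvg_fst.
  exact: cvg_snd.
by apply: filterS2 (nE x) ff => -[y z] ? ?; apply/bowenS.
Qed.

Lemma nbhs_bowen_section n (x : X) : nbhs x [set y | B n (x, y)].
Proof.
suff : {for x, continuous (fun y : X => (x, y))}.
  by apply; exact: nbhs_bowen.
by apply: (@continuous_pair_map _ (cst x) id) => z; [exact: cvg_cst|exact: cvg_id].
Qed.

(** Expansiveness says that the intersection of the closed sets
    [[set y | B n (x, y)]] is [x]. *)
Lemma bowen_nbhs_section (x : X) A : nbhs x A ->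
  exists n, forall y, B n (x, y) -> A y.
Proof.
move=> nA.
have [n nP] : exists n, [set y | B n (x, y)] `<=` A.
  apply: nested_closed_compact => //.
  - move=> n; apply: (preimage_closed (f := fun y => (x, y))) (closed_bowen (n := n)).
    by move=> y _; apply: (@continuous_pair_map _ (cst x) id) => z;
      [exact: cvg_cst|exact: cvg_id].
  - by move=> m n mn y; exact: bowen_le.
  - by move=> y /bowen_eq <-.
by exists n.
Qed.

(** When both hypotheses hold for every [P], the three points are equal, so
    [(x, z)] is interior to [E]. *)
Lemma bowen_triangle0 : exists P, forall x y z,
  B P (x, y) -> B P (y, z) -> E (x, z).
Proof.
pose C n := [set p : X * X * X | B n p.1 /\ B n (p.1.2, p.2)].
have c12 : continuous (fun p : X * X * X => (p.1.2, p.2)).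
  apply: continuous_pair_map => z; last exact: cvg_snd.
  by apply: continuous_comp; [exact: cvg_fst|exact: cvg_snd].
have c02 : continuous (fun p : X * X * X => (p.1.1, p.2)).
  apply: continuous_pair_map => z; last exact: cvg_snd.
  by apply: continuous_comp; exact: cvg_fst.
have [n nP] : exists n, C n `<=` [set p | E (p.1.1, p.2)].
  apply: nested_closed_compact.
  - by apply: compact_prod => //; exact: compact_prod.
  - move=> n; apply: closedI.
      by apply: preimage_closed (closed_bowen (n := n)) => p _; exact: cvg_fst.
    by apply: (preimage_closed _ (closed_bowen (n := n))) => p _; exact: c12.
  - by move=> m n mn p [? ?]; split; exact: bowen_le mn _ _.
  - move=> [[x y] z] h.
    have <- : x = y by apply: bowen_eq => n; exact: (h n).1.
    have <- : y = z by apply: bowen_eq => n; exact: (h n).2.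
    have <- : x = y by apply: bowen_eq => n; exact: (h n).1.
    by apply: c02; exact: nE.
by exists n => x y z xy yz; exact: (nP (x, y, z)).
Qed.

(** Since [bowen] is defined by conditions on the iterates, the basic case applies
    at every time [j <= n] with the same [P].  Going from [P + n] to [n] plays the
    role of doubling a radius. *)
Lemma bowen_triangle : exists P, forall n x y z,
  B (P + n) (x, y) -> B (P + n) (y, z) -> B n (x, z).
Proof.
have [P PP] := bowen_triangle0; exists P => n x y z xy yz j jn.
have PjPn : (P + j <= P + n)%N by rewrite leq_add2l.
apply: (PP _ (iter j f y)); apply: bowen_iter; exact: bowen_le PjPn _ _.
Qed.

(** The limit case [z = f x] is an open condition on [(x, z)], by openness of [f];
    compactness makes the size of the neighborhood uniform. *)
Lemma bowen_lift0 : exists N, forall x z, B N (f x, z) ->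
  exists2 w, f w = z & E (x, w).
Proof.
pose O := [set p | exists2 w, f w = p.2 & E (p.1, w)].
have cf1 : continuous (fun p : X * X => (f p.1, p.2)).
  apply: continuous_pair_map => z; last exact: cvg_snd.
  by apply: continuous_comp; [exact: cvg_fst|exact: cf].
have [N NP] : exists N, (fun p : X * X => (f p.1, p.2)) @^-1` B N `<=` O.
  apply: nested_closed_compact.
  - exact: compact_prod.
  - by move=> n; apply: preimage_closed (closed_bowen (n := n)) => p _; exact: cf1.
  - by move=> m n mn p; exact: bowen_le.
  - move=> [x z] /= /bowen_eq <-.
    have [[U V] /= [nU nV] UVE] := nE x.
    exists (U, f @` V) => /=; first by split => //; exact: open_f.
    by move=> [y _] /= [Uy [w Vw <-]]; exists w => //; exact: (UVE (y, w)).
by exists N => x z /(NP (x, z)).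
Qed.

(** A one-step lift [w] of a point close to [f x] is [E]-close to [x] and its image
    is [B n]-close to [f x], so it is [B n.+1]-close to [x].  This gain replaces the
    contraction of the inverse branches and lets the lifting be repeated
    indefinitely with the same [N]. *)
Lemma bowen_lift : exists N, forall n M x z, B (N + n) (iter M f x, z) ->
  exists2 w, iter M f w = z & B (N + n + M) (x, w).
Proof.
have [N NP] := bowen_lift0; exists N => n M; elim: M => [|M IH] x z.
  by rewrite addn0; exists z.
rewrite iterSr => /IH [y yz By].
have [|w wy Ew] := NP x y.
  by apply: bowen_le By; rewrite -addnA leq_addr.
exists w; first by rewrite iterSr wy.
by rewrite addnS; apply/bowenS; rewrite wy.
Qed.

Lemma bowen_cat m k x y :
  B m (x, y) -> B k (iter m f x, iter m f y) -> B (m + k) (x, y).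
Proof.
move=> h1 h2 j jmk; case: (leqP j m) => [|/ltnW] mj; first exact: h1.
rewrite -(subnK mj) !iterD; apply: h2.
by rewrite leq_subLR.
Qed.

(** Lifting [z] repeatedly along its own return orbit gives points [u i] close to
    [z] with [iter m f (u i.+1) = u i].  The iterates of [u i] and [u i.+1] at the
    multiples of [m] all stay close to [z], hence to each other, for a time that
    grows with [i]; so [u i.+1] is nearly fixed by [iter m f], and a limit point is
    fixed. *)
Lemma closing_lemma n : exists L m0, forall z m, (m0 <= m)%N ->
  B L (iter m f z, z) -> exists2 p, iter m f p = p & B n (z, p).
Proof.
have [P tri] := bowen_triangle; have [N lift] := bowen_lift.
(* each level is chosen so that one triangle inequality leaves what [lift] needs *)
pose D := (N + (P + n))%N.
exists (P + D)%N, P.+1 => z m Pm zm.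
have m0 : (0 < m)%N by exact: leq_ltn_trans Pm.
have step u : B (D + m) (z, u) ->
    exists2 w, iter m f w = u & B (D + m) (z, w).
  move=> zu; apply: lift; apply: tri zm _; apply: bowen_le zu.
  by rewrite -/D addnC leq_add2l ltnW.
have /choice[g gP] u : exists w, B (D + m) (z, u) ->
    iter m f w = u /\ B (D + m) (z, w).
  have [/step[w ? ?]|nzu] := pselect (B (D + m) (z, u)); first by exists w.
  by exists u.
pose u i := iter i g z.
have uz i : B (D + m) (z, u i).
  elim: i => [|i IH]; first exact: bowen_refl.
  by rewrite /= ; apply: (gP _ IH).2.
have fu i : iter m f (u i.+1) = u i by apply: (gP _ (uz i)).1.
have uu i j : B m (u i, u j).
  apply: (tri _ _ z); last apply: bowen_le (uz j).
    by apply: bowen_sym; apply: bowen_le (uz i); rewrite leq_add2r /D; lia.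
  by rewrite leq_add2r /D; lia.
have ucl i : B (i * m) (u i, u i.+1).
  elim: i => [|i IH]; first exact: bowen_le (uu _ _).
  by rewrite mulSn; apply: bowen_cat => //; rewrite !fu.
(* the points near [z] that [iter m f] moves little, less and less as [k] grows *)
pose C k := [set p | B k (iter m f p, p) /\ B n (z, p)].
have [p Cp] : exists p, forall k, C k p.
  apply: contrapT => noC.
  have [k Ck] : exists k, C k `<=` set0.
    apply: nested_closed_compact => //.
    - move=> k; apply: closedI.
        apply: (preimage_closed (f := fun p => (iter m f p, p)))
          (closed_bowen (n := k)).
        move=> p _; apply: continuous_pair_map; first exact: continuous_iter.
        by move=> ?; exact: cvg_id.
      apply: (preimage_closed (f := fun y => (z, y))) (closed_bowen (n := n)).
      by move=> y _; apply: (@continuous_pair_map _ (cst z) id) => ?;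
        [exact: cvg_cst|exact: cvg_id].
    - by move=> k l kl p [? ?]; split => //; exact: bowen_le kl _ _.
    - by move=> p pC; exfalso; apply: noC; exists p.
  apply: (Ck (u k.+1)); split.
    by rewrite fu; apply: bowen_le (ucl k); rewrite leq_pmulr.
  by apply: bowen_le (uz _); rewrite /D; lia.
exists p; first by apply: bowen_eq => k; exact: (Cp k).1.
exact: (Cp 0%N).2.
Qed.

Lemma bowen_avoid (s : seq X) y : y \notin s ->
  exists n, forall w, B n (y, w) -> w \notin s.
Proof.
move=> ys; have [n nP] : exists n, forall a, a \in s -> ~ B n (y, a).
  apply: seq_uniform_bound => [a k l kl nB /(bowen_le kl)//|a sa].
  apply/not_existsP => h; move: ys; rewrite (_ : y = a) ?sa//.
  by apply: bowen_eq => n; apply: contrapT; exact: h.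
by exists n => w Bw; apply/negP => /nP.
Qed.

Definition cycle_set p m := [set iter j f p | j in [set j | (j < m)%N]].

Lemma iter_period p m j k : iter m f p = p -> iter (j + m * k) f p = iter j f p.
Proof.
move=> pm; rewrite iterD; congr (iter j f _).
by elim: k => [|k IH]; rewrite ?muln0// mulnS addnC iterD pm.
Qed.

Lemma cycle_set_iter p m j : (0 < m)%N -> iter m f p = p ->
  cycle_set p m (iter j f p).
Proof.
move=> m0 pm; exists (j %% m)%N => /=; first by rewrite ltn_mod.
by rewrite [in RHS](divn_eq j m) addnC mulnC iter_period.
Qed.

Lemma cycle_setE p m : cycle_set p m =
  [set` [seq iter j f p | j <- iota 0 m]].
Proof.
apply/seteqP; split=> [_ [j /= jm <-]|y /= /mapP[j]].
  by apply/mapP; exists j => //; rewrite mem_iota.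
by rewrite mem_iota => jm ->; exists j.
Qed.

(** Along a cycle of length [m], one step backwards is [m.-1] steps forwards, so
    [iter (m.-1 * i) f p] is the backward orbit of [p] in its cycle.  Lifting [w]
    along it gains one unit of closeness at each step, so that the preorbit so
    obtained converges to the cycle. *)
Lemma local_unstable : exists N, forall p m w, (0 < m)%N -> iter m f p = p ->
  B N (p, w) -> unstable_set f (cycle_set p m) w.
Proof.
have [N lift] := bowen_lift; exists N => p m w m0 pm pw.
pose q i := iter (m.-1 * i) f p.
have fq i : f (q i.+1) = q i.
  rewrite /q -iterS -[in RHS](iter_period (m.-1 * i) 1 pm).
  congr (iter _ f p); rewrite mulnS muln1 addnC.
  by case: m m0 {pm q} => //= m _; rewrite addnS addnC.
have step i u : B (N + i) (q i, u) ->
    exists2 v, f v = u & B (N + i.+1) (q i.+1, v).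
  rewrite -fq => qu; have [v vu] := lift i 1%N (q i.+1) u qu.
  by rewrite -addnA addn1 => qv; exists v.
have /choice[g gP] (iu : nat * X) : exists v, B (N + iu.1) (q iu.1, iu.2) ->
    f v = iu.2 /\ B (N + iu.1.+1) (q iu.1.+1, v).
  case: iu => i u /=; have [/step[v ? ?]|?] := pselect (B (N + i) (q i, u)).
    by exists v.
  by exists u.
pose x := fix x i := if i is j.+1 then g (j, x j) else w.
have qx i : B (N + i) (q i, x i).
  elim: i => [|i IH]; first by rewrite /q muln0 addn0.
  exact: (gP (i, x i) IH).2.
exists x; first by split => // i; exact: (gP (i, x i) (qx i)).1.
move=> U nU.
have [n nP] : exists n, forall a, a \in [seq iter j f p | j <- iota 0 m] ->
    forall y, B n (a, y) -> U y.
  apply: seq_uniform_bound => [a k l kl h y /(bowen_le kl)|a sa]; first exact: h.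
  apply: bowen_nbhs_section; apply: nU.
  by rewrite cycle_setE.
exists n => // i /= ni.
apply: (nP (q i)); last by apply: bowen_le (qx i); rewrite (leq_trans ni)// leq_addl.
have : cycle_set p m (q i) by exact: cycle_set_iter.
by rewrite cycle_setE.
Qed.

Lemma unstable_iter (gamma : set X) w j : unstable_set f gamma w ->
  unstable_set f gamma (iter j f w).
Proof.
move=> Ww; elim: j => // j [x [x0 fx] cx].
exists (fun i => if i is k.+1 then x k else iter j.+1 f w).
  by split => // -[|i] //=; rewrite x0.
by move=> U /cx h; apply: near_inftyS.
Qed.

(** A partition into pieces that are small for [bowen n], given by its label map
    [c]. *)
Lemma exists_coding n : exists (s : seq X) (c : X -> X),
  (forall x, c x \in s) /\ (forall x y, c x = c y -> B n (x, y)).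
Proof.
have [P tri] := bowen_triangle.
have [s sP] := compact_finite_nbhs_cover cX (nbhs_bowen_section (P + n)).
have /choice[c cP] y : exists x, x \in s /\ B (P + n) (x, y).
  by have [x ? ?] := sP y I; exists x.
exists s, c; split=> [x|x y cxy]; first exact: (cP x).1.
apply: (tri _ _ (c x)); first by apply: bowen_sym; exact: (cP x).2.
by rewrite cxy; exact: (cP y).2.
Qed.

Definition frequent (c : X -> X) a y :=
  forall k, exists2 n, (k <= n)%N & c (iter n f y) = a.

Lemma exists_frequent (s : seq X) (c : X -> X) y : (forall x, c x \in s) ->
  exists2 a, a \in s & frequent c a y.
Proof.
move=> cs; apply: contrapT => noa.
have [k kP] : exists k, forall a, a \in s ->
    forall n, (k <= n)%N -> c (iter n f y) <> a.
  apply: seq_uniform_bound => [a k l kl h n ln|a sa].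
    by apply: h; exact: leq_trans ln.
  apply: contrapT => noN; apply: noa; exists a => // k.
  apply: contrapT => noM; apply: noN; exists k => n kn cn; apply: noM.
  by exists n.
exact: (kP _ (cs (iter k f y)) k).
Qed.

Lemma countable_seq_bigcup (s : seq X) (D : X -> set X) :
  (forall a, a \in s -> countable (D a)) ->
  countable [set x | exists2 a, a \in s & D a x].
Proof.
move=> h; rewrite (_ : mkset _ = \bigcup_(a in [set` s]) D a).
  apply: bigcup_countable => //; apply: finite_set_countable.
  exact: finite_seq.
by apply/seteqP; split=> x [a sa Da]; exists a.
Qed.

(** [f] is injective on each piece of a coding: two points of the same piece with the
    same image stay [E]-close forever. *)
Lemma countable_preimage_iter (A : set X) k : countable A ->
  countable (iter k f @^-1` A).
Proof.
move=> cA; elim: k => // k IH.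
have [s [c [cs cE]]] := exists_coding 0.
have -> : iter k.+1 f @^-1` A =
    [set x | exists2 a, a \in s & c x = a /\ (iter k f @^-1` A) (f x)].
  apply/seteqP; split=> x.
    by rewrite /preimage/= -iterS iterSr => Ax; exists (c x).
  by move=> [a _ [_]]; rewrite /preimage/= -iterSr.
apply: countable_seq_bigcup => a sa.
apply: countable_inj (f) _ _ IH => [x y|x []//].
rewrite !inE => -[cx _] [cy _] fxy; apply: bowen_eq => -[|n].
  by apply: cE; rewrite cx.
by apply/bowenS; rewrite fxy; split; [apply: (cE x y _ 0%N) => //; rewrite cx|
  exact: bowen_refl].
Qed.

(** Every point has an iterate that comes back infinitely often to its own piece.  If
    such iterates formed a countable set, so would all their preimages. *)
Lemma uncountable_frequent (s : seq X) (c : X -> X) : (forall x, c x \in s) ->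
  ~ countable [set: X] ->
  exists a, ~ countable [set y | c y = a /\ frequent c a y].
Proof.
move=> cs; apply: contra_notP => /forallNP h.
have -> : [set: X] = \bigcup_k (iter k f @^-1`
   [set y | exists2 a, a \in s & c y = a /\ frequent c a y]).
  apply/seteqP; split=> // x _; have [a sa fa] := exists_frequent x cs.
  have [k _ ck] := fa 0%N; exists k => //; exists a => //; split => // l.
  have [n ln cn] := fa (l + k)%N; exists (n - k)%N; first by lia.
  by rewrite -iterD subnK //; lia.
apply: bigcup_countable => // k _; apply: countable_preimage_iter.
by apply: countable_seq_bigcup => a _; apply: contrapT; exact: h.
Qed.

Lemma cycle_set_countable p m : countable (cycle_set p m).
Proof.
by apply: finite_set_countable; rewrite cycle_setE; exact: finite_seq.
Qed.

(** The points [z] and [y] are two points that come back infinitely often to the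
    same piece [a]: [p] is the periodic point obtained by closing the orbit of [z],
    and [w] is [p] lifted along the orbit of [y]. *)
Lemma exists_homoclinic_point : ~ countable [set: X] ->
  exists p m w M, [/\ (0 < m)%N, iter m f p = p,
    unstable_set f (cycle_set p m) w, iter M f w = p & ~ cycle_set p m w].
Proof.
move=> unX.
have [P tri] := bowen_triangle; have [N lift] := bowen_lift.
have [Nu unst] := local_unstable.
(* room for two triangle inequalities, then for [unst] and for [lift] *)
pose D := (P + (P + (Nu + N)))%N.
have [L [m0 close]] := closing_lemma D.
have [s [c [cs cE]]] := exists_coding (maxn L D).
have [a Ya] := uncountable_frequent cs unX.
have [z [cz fz]] : exists z, c z = a /\ frequent c a z.
  apply: contrapT => noz; apply: Ya.
  rewrite (_ : mkset _ = set0); first exact: countable0.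
  by apply/seteqP; split=> // z ?; apply: noz; exists z.
have [m mm0 cm] := fz m0.+1.
have [|p pm zp] := close z m (ltnW mm0).
  by apply: bowen_le (leq_maxl L D) _ _; apply: cE; rewrite cm.
have m_gt0 : (0 < m)%N by exact: leq_ltn_trans mm0.
have [y [[cy fy] ny]] : exists y, (c y = a /\ frequent c a y) /\ ~ cycle_set p m y.
  apply: contrapT => noy; apply: Ya.
  apply: sub_countable (cycle_set_countable p m); apply: subset_card_le => y Yy.
  by apply: contrapT => ny; apply: noy; exists y.
have [n nP] : exists n, forall w, B n (y, w) -> ~ cycle_set p m w.
  rewrite cycle_setE in ny *; have [n nP] := bowen_avoid (introN idP ny).
  by exists n => w /nP /negP.
have [M Mn cM] := fy (n + D)%N.
have close_code u v : c u = c v -> B D (u, v).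
  by move=> /cE; apply: bowen_le; exact: leq_maxr.
have yp : B N (iter M f y, p).
  by apply: (tri _ _ z); [apply: bowen_le (close_code _ _ _); rewrite ?cM// /D|
    apply: bowen_le zp; rewrite /D]; lia.
have [|w wp yw] := lift 0%N M y p; first by rewrite addn0.
exists p, m, w, M; split => //; last first.
  by apply: nP; apply: bowen_le yw; lia.
apply: unst => //.
apply: (tri _ _ z); first by apply: bowen_sym; apply: bowen_le zp; rewrite /D; lia.
apply: (tri _ _ y); last by apply: bowen_le yw; lia.
by apply: bowen_le (close_code _ _ _); rewrite ?cz// /D; lia.
Qed.

Section DenseOrbit.
Variable q : X.
Hypothesis dense_q : forall (x : X) A, nbhs x A -> exists i, A (iter i f q).
Hypothesis infX : ~ countable [set: X].

Lemma bowen_visit n x : exists i, B n (x, iter i f q).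
Proof. exact: (dense_q (nbhs_bowen_section n x)). Qed.

(** The images of an isolated point [x] are isolated, since [f] is open.  Some image
    of [x] comes back close to itself, at a time as late as desired; its lift along
    this return is so close to it that it is equal to it.  So [x] is eventually
    periodic.  As [x] is visited by the dense orbit, that orbit is finite, and then
    so is [X]. *)
Lemma dense_orbit_no_isolated x n : exists2 y, B n (x, y) & y <> x.
Proof.
apply: contrapT => iso0.
have iso y : B n (x, y) -> y = x.
  by move=> xy; apply: contrapT => yx; apply: iso0; exists y.
have {iso0} isolated i : exists k, forall y, B k (iter i f x, y) -> y = iter i f x.
  suff : nbhs (iter i f x) [set iter i f x].
    by move=> /bowen_nbhs_section[k kP]; exists k.
  elim: i => [|i /open_f]; last by rewrite image_set1.
  by apply: filterS (nbhs_bowen_section n x) => y /iso.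
have [N lift] := bowen_lift.
have [s [c [cs cE]]] := exists_coding N.
have [a _ fa] := exists_frequent x cs.
have [i _ ci] := fa 0%N; have [k kP] := isolated i.
have [j ij cj] := fa (i + k).+1.
have [|w wi iw] := lift 0%N (j - i)%N (iter i f x) (iter i f x).
  by rewrite addn0 -iterD subnK; [apply: cE; rewrite ci|lia].
have wE : w = iter i f x by apply: kP; apply: bowen_le iw; lia.
have [l] := bowen_visit n x; move=> /iso ql.
pose t := [seq iter r f q | r <- iota 0 (j + l)].
have qt r : iter r f q \in t.
  elim/ltn_ind: r => r IH; case: (ltnP r (j + l)) => rj.
    by apply/mapP; exists r => //; rewrite mem_iota.
  (* from time [i + l] on, the orbit of [q] has period [j - i] *)
  have -> : r = ((r - (j + l)) + (j - i) + (i + l))%N by lia.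
  rewrite iterD iterD [iter (i + l) _ _]iterD ql -[in iter (j - i) _ _]wE wi.
  by rewrite -ql -!iterD; apply: IH; lia.
apply: infX; rewrite (_ : [set: X] = [set` t]).
  by apply: finite_set_countable; exact: finite_seq.
apply/seteqP; split=> // y _ /=; apply: contrapT => /negP /bowen_avoid[r rP].
by have [v /rP] := bowen_visit r y; rewrite qt.
Qed.

(** Without isolated points, there are points near [x] outside the finite initial
    segment of length [k] of the orbit; only later times can approach them. *)
Lemma bowen_visit_late n x k : exists2 i, (k <= i)%N & B n (x, iter i f q).
Proof.
have [P tri] := bowen_triangle.
pose s := [seq iter i f q | i <- iota 0 k].
have [y xy ys] : exists2 y, B (P + n) (x, y) & y \notin s.
  have [|r rP] := @bowen_avoid [seq w <- s | w != x] x.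
    by rewrite mem_filter eqxx.
  have [y xy yx] := dense_orbit_no_isolated x (maxn r (P + n)).
  exists y; first by apply: bowen_le xy; exact: leq_maxr.
  have := rP y (bowen_le (leq_maxl _ _) xy).
  by rewrite mem_filter (introN eqP yx).
have [r rP] := bowen_avoid ys.
have [i yi] := bowen_visit (maxn r (P + n)) y.
exists i; last by apply: (tri _ _ y) => //; apply: bowen_le yi; exact: leq_maxr.
rewrite leqNgt; apply/negP => ik.
have := rP (iter i f q); rewrite (_ : _ \in s); last first.
  by apply/mapP; exists i => //; rewrite mem_iota.
by move=> /(_ (bowen_le (leq_maxl _ _) yi)).
Qed.

(** The orbit of [q] is close to [p], [x] and [p] at the times [i <= j <= k].  The
    point [p] is lifted from time [k] to time [i], where the lift is close to [p],
    hence in the unstable set; the image of the lift at time [j] is close to [x]. *)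
Lemma dense_orbit_homoclinic p m (x : X) A : (0 < m)%N -> iter m f p = p ->
  nbhs x A -> exists w M, [/\ A w, unstable_set f (cycle_set p m) w &
    iter M f w = p].
Proof.
move=> m0 pm /bowen_nbhs_section[n nA].
have [P tri] := bowen_triangle; have [N lift] := bowen_lift.
have [Nu unst] := local_unstable.
have [i _ ip] := bowen_visit_late (P + Nu) p 0.
have [j ij xj] := bowen_visit_late (P + n) x i.
have [k jk pk] := bowen_visit_late N p (j + P + n + Nu).
have [|w wp iw] := lift 0%N (k - i)%N (iter i f q) p.
  by rewrite addn0 -iterD subnK; [exact: bowen_sym|lia].
exists (iter (j - i) f w), (k - j)%N; split.
- apply: nA; apply: (tri _ _ (iter j f q)) => //.
  rewrite -{1}(subnK ij) iterD.
  by apply: bowen_iter; apply: bowen_le iw; lia.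
- apply: unstable_iter; apply: unst => //.
  by apply: (tri _ _ (iter i f q)) => //; apply: bowen_le iw; lia.
- by rewrite -iterD (_ : (_ + _)%N = (k - i)%N)//; lia.
Qed.

End DenseOrbit.
End ExpansiveOpen.

Local Open Scope ring_scope.

(** * Strict differentiability *)

Lemma mx_norm_le_entries (R : realType) m n (A : 'M[R]_(m, n)) (c : R) :
  0 <= c -> (forall i j, `|A i j| <= c) -> `|A| <= c.
Proof.
move=> c0 h; rewrite /Num.norm /= mx_normrE; by apply/bigmax_leP; split=> // -[i j] _; exact: h.
Qed.

Lemma entry_le_mx_norm (R : realType) m n (A : 'M[R]_(m, n)) i j :
  `|A i j| <= `|A|.
Proof.
rewrite [leRHS]/Num.norm /= mx_normrE.
exact: (le_bigmax _ (fun ij : 'I_m * 'I_n => `|A ij.1 ij.2|) (i, j)).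
Qed.

Lemma mulmx_norm_le (R : realType) m n p (A : 'M[R]_(m, n)) (B : 'M[R]_(n, p)) :
  `|A *m B| <= n%:R * `|A| * `|B|.
Proof.
apply: mx_norm_le_entries => [|i j]; first by rewrite !mulr_ge0.
rewrite mxE (le_trans (ler_norm_sum _ _ _))//.
apply: (@le_trans _ _ (\sum_(k < n) `|A| * `|B|)); last first.
  by rewrite sumr_const card_ord -mulrA mulr_natl.
apply: ler_sum => k _; rewrite normrM.
by apply: ler_pM => //; exact: entry_le_mx_norm.
Qed.

(** Strict differentiability: the linear approximation is uniform in pairs of
    points near [a].  Such pairs are what expansion estimates are about, and the
    notion composes without any continuity of derivatives around [a].  The matrix
    acts on rows. *)
Definition strict_diff (R : realType) n p (F : 'rV[R]_n -> 'rV[R]_p)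
    (a : 'rV[R]_n) (A : 'M[R]_(n, p)) : Prop :=
  forall e, 0 < e -> exists2 d, 0 < d & forall y z, `|y - a| < d ->
    `|z - a| < d -> `|F y - F z - (y - z) *m A| <= e * `|y - z|.

Section StrictDifferentiability.
Context (R : realType).

Lemma continuous_at_dist (V W : normedModType R) (F : V -> W) a :
  (forall e, 0 < e -> exists2 d, 0 < d & forall y, `|y - a| < d ->
    `|F y - F a| <= e) -> {for a, continuous F}.
Proof.
move=> h; apply/(@cvgrPdist_le _ _ _ (nbhs a) _ F (F a)) => e /h[d d0 dP].
apply/nbhs_ballP; exists d => //= y; rewrite -ball_normE /= => ya.
by rewrite distrC dP// distrC.
Qed.

Lemma diff_of_dist (V W : normedModType R) (F : V -> W) (D : {linear V -> W})
    a : continuous D ->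
  (forall e, 0 < e -> exists2 d, 0 < d & forall h, `|h| < d ->
    `|F (h + a) - F a - D h| <= e * `|h|) ->
  differentiable F a /\ 'd F a = D :> (V -> W).
Proof.
move=> cD hD; suff Fo : F \o shift a = cst (F a) + D +o_ 0 id.
  have dE := diff_unique cD Fo; split => //.
  by apply/diff_locallyP; rewrite dE.
apply/eqaddoP => e /hD[d d0 dP].
apply/nbhs_ballP; exists d => //= h; rewrite -ball_normE /= sub0r normrN => hd.
by have := dP h hd; rewrite -addrA -opprD.
Qed.

Lemma is_derive_segment n p (F : 'rV[R]_n -> 'rV[R]_p) (z v : 'rV[R]_n)
    (i : 'I_p) (t : R) : derivable F (z + t *: v) v ->
  is_derive t (1 : R) (fun s => F (z + s *: v) 0 i) (('D_v F (z + t *: v)) 0 i).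
Proof.
move=> dF.
have quotE : (fun h : R => h^-1 *: (F (z + (h *: 1 + t) *: v) 0 i
      - F (z + t *: v) 0 i)) =
    (fun M : 'rV[R]_p => M 0 i) \o
    (fun h : R => h^-1 *: (F (h *: v + (z + t *: v)) - F (z + t *: v))).
  apply/funext => h; rewrite /= !mxE; congr (_ * (F _ 0 i - _)).
  by rewrite scalerDl [h *: 1]mulr1 addrCA.
have cq : (fun h : R => h^-1 *: (F (z + (h *: 1 + t) *: v) 0 i
      - F (z + t *: v) 0 i)) @ 0^' --> ('D_v F (z + t *: v)) 0 i.
  rewrite quotE; apply: (@continuous_cvg _ _ _ _ _ _ (fun M : 'rV[R]_p => M 0 i)).
    exact: coord_continuous.
  exact: dF.
by apply: DeriveDef; [apply: cvgP cq|exact: cvg_lim cq].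
Qed.

(** Mean value theorem on the segment from [z] to [y], coordinate by coordinate: the
    Jacobian at the intermediate point is close to the one at [a]. *)
Lemma C1_strict_diff n p (F : 'rV[R]_n -> 'rV[R]_p) (U : set 'rV[R]_n) a :
  nbhs a U -> Ck 1 U F -> strict_diff F a (jacobian F a).
Proof.
move=> nU [dF cF] e e0.
have Ua : U a by exact: nbhs_singleton.
(* [mulmx_norm_le] costs a factor [n]; [n.+1] also covers [n = 0] *)
pose e' : R := e / n.+1%:R.
have e'0 : 0 < e' by rewrite divr_gt0.
have nD : \forall w \near a,
    forall j : 'I_n, `|'D_(delta_mx 0 j) F w - 'D_(delta_mx 0 j) F a| < e'.
  apply: (@filter_forall _ _ (fun j w => `|'D_(delta_mx 0 j) F w
     - 'D_(delta_mx 0 j) F a| < e') (nbhs a)) => j.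
  have cD : {for a, continuous ('D_(delta_mx 0 j) F)}.
    by apply: (cF (delta_mx 0 j)); exact: mem_set.
  move/cvgrPdist_lt : cD => /(_ _ e'0).
  by apply: filterS => w; rewrite distrC.
have nUD : nbhs a (U `&` [set w | forall j : 'I_n,
    `|'D_(delta_mx 0 j) F w - 'D_(delta_mx 0 j) F a| < e']) by exact: filterI.
have /nbhs_ballP[d /= d0 dP] := nUD; exists d => // y z ya za.
have seg (t : R) : 0 <= t <= 1 -> ball a d (z + t *: (y - z)).
  move=> /andP[t0 t1]; rewrite -ball_normE /= distrC.
  have -> : z + t *: (y - z) - a = (1 - t) *: (z - a) + t *: (y - a).
    by apply/rowP => k; rewrite !mxE; ring.
  rewrite (le_lt_trans (ler_normD _ _))// !normrZ !ger0_norm ?subr_ge0//.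
  have [->|t0'] := eqVneq t 0; first by rewrite subr0 mul1r mul0r addr0.
  have tp : 0 < t by rewrite lt_neqAle eq_sym t0'.
  have : t * `|y - a| < t * d by rewrite ltr_pM2l.
  have : (1 - t) * `|z - a| <= (1 - t) * d by rewrite ler_wpM2l ?subr_ge0// ltW.
  lra.
apply: mx_norm_le_entries => [|i k]; first by rewrite mulr_ge0// ltW.
rewrite ord1 {i}.
pose g t := F (z + t *: (y - z)) 0 k.
have dg (t : R) : 0 <= t <= 1 ->
    is_derive t (1:R) g (('D_(y - z) F (z + t *: (y - z))) 0 k).
  move=> /seg/dP[Uw _]; apply: is_derive_segment.
  by apply: diff_derivable; exact: dF.
have [||t t01] := @MVT R g (fun t => ('D_(y - z) F (z + t *: (y - z))) 0 k) 0 1 ltr01.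
- by move=> t; rewrite in_itv /= => /andP[t0 t1]; apply: dg; rewrite !ltW.
- apply: derivable_within_continuous => t; rewrite in_itv /= => /dg dgt.
  exact: ex_derive.
rewrite subr0 mulr1 /g scale1r scale0r addr0 subrKC => gE.
have tI : 0 <= t <= 1.
  by move: t01; rewrite in_itv /= => /andP[t0 t1]; rewrite !ltW.
have [Uw Dw] := dP _ (seg t tI).
move: (z + t *: (y - z)) gE Uw Dw => w gE Uw Dw.
have {}gE : F y 0 k - F z 0 k = ((y - z) *m jacobian F w) 0 k.
  by rewrite gE (deriveEjacobian (y - z) (dF w Uw)).
have subE (A B : 'rV[R]_p) : (A - B) 0 k = A 0 k - B 0 k by rewrite !mxE.
have -> : (F y - F z - (y - z) *m jacobian F a) 0 k =
    ((y - z) *m (jacobian F w - jacobian F a)) 0 k.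
  by rewrite mulmxBr !subE gE.
apply: le_trans (entry_le_mx_norm _ _ _) _.
apply: le_trans (mulmx_norm_le _ _) _.
have JJ : `|jacobian F w - jacobian F a| <= e'.
  apply: mx_norm_le_entries => [|j i]; first exact: ltW.
  have := ltW (Dw j); apply: le_trans.
  rewrite (deriveEjacobian (delta_mx 0 j) (dF w Uw)).
  rewrite (deriveEjacobian (delta_mx 0 j) (dF a Ua)).
  rewrite -mulmxBr -rowE.
  by have := entry_le_mx_norm (row j (jacobian F w - jacobian F a)) 0 i; rewrite mxE.
have ne : n%:R * e' <= e.
  by rewrite mulrC /e' -mulrA ler_piMr ?ltW// mulrC ltr_pdivrMr// mul1r ltr_nat.
apply: (@le_trans _ _ (n%:R * `|y - z| * e')).
  by rewrite ler_wpM2l// mulr_ge0.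
by rewrite mulrAC ler_wpM2r.
Qed.

Lemma strict_diff_lipschitz n p (F : 'rV[R]_n -> 'rV[R]_p) a A :
  strict_diff F a A -> exists d c : R, [/\ 0 < d, 0 < c &
    forall y z, `|y - a| < d -> `|z - a| < d -> `|F y - F z| <= c * `|y - z|].
Proof.
move=> /(_ 1 ltr01)[d d0 dP]; exists d, (1 + n%:R * `|A|); split => //.
move=> y z ya za; rewrite -[F y - F z](subrK ((y - z) *m A)).
apply: le_trans (ler_normD _ _) _; rewrite mulrDl lerD ?dP//.
by rewrite mulrAC mulmx_norm_le.
Qed.

Lemma strict_diff_continuous n p (F : 'rV[R]_n -> 'rV[R]_p) a A :
  strict_diff F a A -> {for a, continuous F}.
Proof.
move=> /strict_diff_lipschitz[d [c [d0 c0 dP]]]; apply: continuous_at_dist.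
move=> e e0; exists (Num.min d (c^-1 * e)).
  by rewrite lt_min d0 mulr_gt0// invr_gt0.
move=> y; rewrite lt_min => /andP[yd yc].
apply: le_trans (dP _ _ yd _) _; first by rewrite subrr normr0.
by rewrite -ler_pdivlMl// ltW.
Qed.

Lemma strict_diff_differentiable n p (F : 'rV[R]_n -> 'rV[R]_p) a A :
  strict_diff F a A -> differentiable F a /\ jacobian F a = A.
Proof.
move=> sF.
have clin : continuous (mulmxr A : 'rV[R]_n -> 'rV[R]_p).
  move=> x; apply: (@strict_diff_continuous _ _ _ _ A) => e e0; exists 1 => //.
  by move=> y z _ _ /=; rewrite -mulmxBl subrr normr0 mulr_ge0// ltW.
have [|dF dE] := @diff_of_dist _ _ F (mulmxr A) a clin.
  move=> e /sF[d d0 dP]; exists d => // h hd.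
  by have := dP (h + a) a; rewrite addrK subrr normr0; exact.
split => //.
apply/matrixP => i j; rewrite /jacobian /lin1_mx mxE dE /=.
by rewrite -rowE mxE.
Qed.

Lemma strict_diff_comp n p q (F : 'rV[R]_n -> 'rV[R]_p)
    (G : 'rV[R]_p -> 'rV[R]_q) a A B :
  strict_diff F a A -> strict_diff G (F a) B -> strict_diff (G \o F) a (A *m B).
Proof.
move=> sF sG e e0.
have [d1 [c [d10 c0 lipF]]] := strict_diff_lipschitz sF.
have e2 : 0 < e / (c *+ 2) by rewrite divr_gt0// mulrn_wgt0.
pose b : R := (p%:R * `|B| + 1) *+ 2.
have b0 : 0 < b by rewrite mulrn_wgt0// ltr_wpDl// mulr_ge0.
have [d2 d20 dG] := sG _ e2.
have [d3 d30 dF] := sF _ (divr_gt0 e0 b0).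
exists (Num.min d1 (Num.min d3 (d2 / c))).
  by rewrite !lt_min d10 d30 divr_gt0.
move=> y z; rewrite !lt_min => /and3P[y1 y3 y2] /and3P[z1 z3 z2].
have Fd w : `|w - a| < d1 -> `|w - a| < d2 / c -> `|F w - F a| < d2.
  move=> w1 w2; apply: le_lt_trans (lipF _ _ w1 _) _.
    by rewrite subrr normr0.
  by rewrite mulrC -ltr_pdivlMr.
have := dG _ _ (Fd _ y1 y2) (Fd _ z1 z2); have := dF _ _ y3 z3.
set u := F y - F z - _ => uP; set v := G _ - _ - _ => vP.
have -> : (G \o F) y - (G \o F) z - (y - z) *m (A *m B) = v + u *m B.
  have -> : u *m B = (F y - F z) *m B - (y - z) *m (A *m B).
    by rewrite /u [LHS]mulmxBl mulmxA.
  by rewrite /v /= addrA subrK.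
apply: le_trans (ler_normD _ _) _; rewrite [e]splitr mulrDl lerD//.
  have -> : e / 2 * `|y - z| = e / (c *+ 2) * (c * `|y - z|).
    by field; rewrite gt_eqF.
  by apply: le_trans vP _; rewrite ler_wpM2l ?(ltW e2)//; exact: lipF.
apply: le_trans (mulmx_norm_le _ _) _.
have -> : e / 2 = e / b * (p%:R * `|B| + 1).
  have p0 : 0 < p%:R * `|B| + 1 by rewrite ltr_wpDl// mulr_ge0.
  by rewrite /b; field; rewrite gt_eqF.
have : p%:R * `|B| * `|u| <= p%:R * `|B| * (e / b * `|y - z|).
  by rewrite ler_wpM2l// mulr_ge0.
have : 0 <= e / b * `|y - z| by rewrite mulr_ge0// divr_ge0// ltW.
set eb := e / b; set B' := `|B|; set u' := `|u|; set yz := `|y - z|.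
move=> h1 h2; rewrite mulrDr mulr1 mulrDl [leLHS]mulrAC.
apply: le_trans h2 _.
have -> : p%:R * B' * (eb * yz) = eb * (p%:R * B') * yz by ring.
by rewrite lerDl.
Qed.

Lemma strict_diff_near n p (F G : 'rV[R]_n -> 'rV[R]_p) a A :
  (\forall y \near a, F y = G y) -> strict_diff F a A -> strict_diff G a A.
Proof.
move=> /nbhs_ballP[d1 /= d10 FG] sF e /sF[d2 d20 dP].
exists (Num.min d1 d2); first by rewrite lt_min d10.
move=> y z; rewrite !lt_min => /andP[y1 y2] /andP[z1 z2].
by rewrite -!FG ?dP// -ball_normE /= distrC.
Qed.

Lemma strict_diff_expand n p (F : 'rV[R]_n -> 'rV[R]_p) a A (k l : R) :
  strict_diff F a A -> (forall v : 'rV[R]_n, k * `|v| <= `|v *m A|) -> l < k ->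
  exists2 d, 0 < d & forall y z, `|y - a| < d -> `|z - a| < d ->
    l * `|y - z| <= `|F y - F z|.
Proof.
move=> sF kA lk; have [|d d0 dP] := sF (k - l); first by rewrite subr_gt0.
exists d => // y z ya za; have := dP y z ya za; have := kA (y - z).
have := ler_normD ((y - z) *m A - (F y - F z)) (F y - F z).
rewrite subrK [`|_ - (F y - F z)|]distrC => h1 h2 h3.
have : k * `|y - z| - (k - l) * `|y - z| = l * `|y - z| by ring.
lra.
Qed.

Lemma closed_ball_rV_compact n (a : 'rV[R]_n) (r : R) :
  compact [set y | `|y - a| <= r].
Proof.
apply: bounded_closed_compact.
  exists (`|a| + r); split => [|x xr y /= ya]; first exact: num_real.
  apply: le_trans (ltW xr); rewrite -[y](subrK a) addrC.
  by apply: le_trans (ler_normD _ _) _; rewrite lerD2l.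
have -> : [set y | `|y - a| <= r] = (fun y => `|y - a|) @^-1` [set x | x <= r].
  by [].
apply: preimage_closed; last exact: closed_le.
move=> y _; apply: continuous_at_dist => e e0; exists e => // z zy.
apply: le_trans (ler_dist_dist _ _) _.
by rewrite opprB addrA subrK ltW.
Qed.

(** The local surjectivity in the inverse function theorem.  For [w] close to
    [F a], the distance from [F y] to [w] has a minimum on a small closed ball, and
    it is attained well inside the ball because [F] expands distances from [a].  At
    a positive minimum, a Newton step would at least halve that distance. *)
Lemma strict_diff_open n (F : 'rV[R]_n -> 'rV[R]_n) a A (S : set 'rV[R]_n) :
  strict_diff F a A -> A \in unitmx -> nbhs a S -> nbhs (F a) (F @` S).
Proof.
move=> sF uA /nbhs_ballP[r0 /= r00 r0S].
pose c : R := n%:R * `|invmx A| + 1.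
have c0 : 0 < c by rewrite ltr_wpDl// mulr_ge0.
have invA (v : 'rV[R]_n) : `|v *m invmx A| <= c * `|v|.
  apply: le_trans (mulmx_norm_le _ _) _; rewrite mulrAC ler_wpM2r//.
  by rewrite /c lerDl.
have low (v : 'rV[R]_n) : c^-1 * `|v| <= `|v *m A|.
  by rewrite ler_pdivrMl// -{1}[v](mulmxK uA).
have [|d1 d10 lowF] := strict_diff_expand sF low (l := (c *+ 2)^-1).
  by rewrite ltf_pV2 ?posrE ?mulrn_wgt0// mulr2n ltrDl.
have [|d2 d20 dF] := sF (c *+ 2)^-1.
  by rewrite invr_gt0 mulrn_wgt0.
have [d3 [L [d30 L0 lipF]]] := strict_diff_lipschitz sF.
pose d := Num.min (Num.min r0 d1) (Num.min d2 d3).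
have d0 : 0 < d by rewrite !lt_min r00 d10 d20 d30.
pose r := d / 2.
have rpos : 0 < r by rewrite divr_gt0.
have rd : r < d by rewrite /r; lra.
have [dr0 dd1 dd2 dd3] : [/\ d <= r0, d <= d1, d <= d2 & d <= d3].
  by rewrite !ge_min !lexx !orbT.
apply/nbhs_ballP; exists (r / (c *+ 8)).
  by rewrite /= divr_gt0// mulrn_wgt0.
move=> w; rewrite -ball_normE /= => Faw.
pose D := [set y : 'rV[R]_n | `|y - a| <= r].
have D0 : D !=set0 by exists a; rewrite /D /= subrr normr0 ltW.
have cphi : {within D, continuous (fun y => `|F y - w|)}.
  apply: continuous_in_subspaceT => y; rewrite inE /D /= => ya.
  have yd3 : 0 < d3 - `|y - a| by rewrite subr_gt0; lra.
  apply: continuous_at_dist => e e0.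
  exists (Num.min (d3 - `|y - a|) (L^-1 * e)).
    by rewrite lt_min yd3 mulr_gt0// invr_gt0.
  move=> z; rewrite lt_min => /andP[zy zL].
  apply: le_trans (ler_dist_dist _ _) _; rewrite opprB addrA subrK.
  apply: le_trans (lipF _ _ _ _) _; last by rewrite -ler_pdivlMl// ltW.
    by have := ler_distD y z a; lra.
  by lra.
have [y Dy ymin] := compact_EVT_min D0 (@closed_ball_rV_compact n a r) cphi.
have {}Dy : `|y - a| <= r by move: Dy; rewrite inE.
have aD : a \in D by rewrite inE /D /= subrr normr0 ltW.
have yFa : `|F y - w| <= `|F a - w| by exact: ymin.
have ya2 : `|y - a| <= c *+ 2 * (`|F y - w| + `|F a - w|).
  have := lowF y a; rewrite subrr normr0 => /(_ (le_lt_trans Dy (lt_le_trans rd dd1)) d10).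
  rewrite ler_pdivrMl ?mulrn_wgt0// => /le_trans; apply.
  rewrite ler_pM2l ?mulrn_wgt0//.
  by have := ler_distD w (F y) (F a); rewrite [`|w - F a|]distrC.
have Faw' : c * `|F a - w| < r / 8.
  rewrite ltr_pdivlMr// mulrC mulr_natl -mulrnAl mulrC.
  by rewrite -ltr_pdivlMr// ?mulrn_wgt0.
have cyFa : c * `|F y - w| <= c * `|F a - w| by rewrite ler_pM2l.
(* the Newton step for [F y' = w] *)
pose y' := y + (w - F y) *m invmx A.
have y'y : `|y' - y| <= c * `|F y - w|.
  by rewrite /y' addrAC subrr add0r [X in _ <= _ * X]distrC.
have ya3 : `|y - a| <= 2 * (c * `|F y - w|) + 2 * (c * `|F a - w|).
  by rewrite (le_trans ya2)// -mulrDr -mulrDr mulrA mulr_natl.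
have y'a : `|y' - a| <= r.
  by have := ler_distD y y' a; lra.
have y'D : y' \in D by rewrite inE.
have {y'D}y'min := ymin _ y'D.
have err := dF y' y (le_lt_trans y'a (lt_le_trans rd dd2))
   (le_lt_trans Dy (lt_le_trans rd dd2)).
have e1 : (y' - y) *m A = w - F y by rewrite /y' addrAC subrr add0r mulmxKV.
have e2 : F y' - F y - (y' - y) *m A = F y' - w.
  by rewrite e1; apply/rowP => k; rewrite !mxE; ring.
rewrite e2 in err.
have half : `|F y - w| <= 2^-1 * `|F y - w|.
  apply: le_trans y'min _; apply: le_trans err _.
  rewrite ler_pdivrMl ?mulrn_wgt0//; apply: le_trans y'y _.
  by rewrite -mulr_natl; lra.
have Fyw : F y = w.
  by apply/subr0_eq/eqP; rewrite -normr_eq0; have := normr_ge0 (F y - w); lra.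
exists y => //; apply: r0S; rewrite -ball_normE /= distrC; lra.
Qed.

End StrictDifferentiability.

(** * Quadratic forms *)

Lemma bernoulli_le (R : realType) (l : R) m :
  1 < l -> 1 + m%:R * (l - 1) <= l ^+ m.
Proof.
move=> l1; elim: m => [|m IH]; first by rewrite mul0r addr0 expr0.
have : l * (1 + m%:R * (l - 1)) <= l * l ^+ m.
  by rewrite ler_pM2l//; lra.
rewrite -exprS; apply: le_trans.
rewrite -natr1; have : 0 <= m%:R * (l - 1) * (l - 1).
  by rewrite !mulr_ge0// subr_ge0 ltW.
lra.
Qed.

Lemma power_unbounded (R : realType) (l b : R) : 1 < l ->
  exists2 m, (0 < m)%N & b < l ^+ m.
Proof.
move=> l1; exists (Num.truncn (b / (l - 1))).+1 => //.
apply: lt_le_trans (bernoulli_le _ l1).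
have := truncnS_gt (b / (l - 1)); rewrite ltr_pdivrMr ?subr_gt0//; lra.
Qed.

Section QuadraticForm.
Context (R : realType) (n : nat).
Implicit Types (S : 'M[R]_n) (w : 'rV[R]_n).

Definition qform S w := (w *m S *m w^T) 0 0.

Lemma qformE S w : qform S w = \sum_i (\sum_j w 0 j * S j i) * w 0 i.
Proof. by rewrite /qform mxE; apply: eq_bigr => i _; rewrite !mxE. Qed.

Lemma qformB S T w : qform S w - qform T w = qform (S - T) w.
Proof.
by rewrite /qform mulmxBr mulmxBl [RHS]mxE; congr (_ + _); rewrite [RHS]mxE.
Qed.

Lemma qformZ S (a : R) w : qform S (a *: w) = a ^+ 2 * qform S w.
Proof.
by rewrite /qform -scalemxAl -scalemxAl linearZ /= -scalemxAr !mxE mulrA expr2.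
Qed.

Lemma qform_bound S w : `|qform S w| <= n%:R ^+ 2 * `|S| * `|w| ^+ 2.
Proof.
apply: le_trans (entry_le_mx_norm _ _ _) _.
apply: le_trans (mulmx_norm_le _ _) _.
have wT : `|w^T| <= `|w|.
  by apply: mx_norm_le_entries => // i j; rewrite mxE entry_le_mx_norm.
have h := mulmx_norm_le w S.
apply: (@le_trans _ _ (n%:R * (n%:R * `|w| * `|S|) * `|w|)).
  by rewrite ler_pM// ?mulr_ge0// ler_wpM2l.
by rewrite le_eqVlt; apply/orP; left; apply/eqP; ring.
Qed.

Lemma qform_continuous S : continuous (qform S).
Proof.
have -> : qform S = fun w => \sum_i (\sum_j w 0 j * S j i) * w 0 i.
  by apply/funext => w; rewrite qformE.
apply: (@continuous_big _ _ +%R 0 _ (@add_continuous R)) => i _ w.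
apply: continuousM; last exact: coord_continuous.
apply: (@continuous_big _ _ +%R 0 _ (@add_continuous R)) => j _ v.
by apply: continuousM; [exact: coord_continuous|exact: cst_continuous].
Qed.

(** By homogeneity, the minimum on the unit sphere is such a bound. *)
Lemma pos_qform_bound S : (forall w, w != 0 -> 0 < qform S w) ->
  exists2 b : R, 0 < b & forall w, b * `|w| ^+ 2 <= qform S w.
Proof.
move=> posS.
pose D := [set w : 'rV[R]_n | `|w - 0| <= 1] `&` [set w | 1 <= `|w|].
have [[w0 w00]|/forallNP noD] := pselect (exists w : 'rV[R]_n, w != 0); last first.
  exists 1 => // w; have /negP/negPn/eqP -> := noD w.
  by rewrite normr0 expr0n mulr0 /qform !mul0mx mxE.
have D0 : D !=set0.
  exists (`|w0|^-1 *: w0).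
  by split; rewrite /= ?subr0 normrZ normfV normr_id mulVf ?lexx// normr_eq0.
have cD : compact D.
  apply: compact_closedI; first exact: closed_ball_rV_compact.
  have -> : [set w : 'rV[R]_n | 1 <= `|w|] = (fun w => `|w|) @^-1` [set x | 1 <= x].
    by [].
  apply: preimage_closed; last exact: closed_ge.
  move=> y _; apply: continuous_at_dist => e e0; exists e => // z zy.
  exact: le_trans (ler_dist_dist _ _) (ltW zy).
have [c cD' cmin] := compact_EVT_min D0 cD
  (continuous_subspaceT (@qform_continuous S)).
have {cD'} [_ c1] : D c by rewrite -inE.
exists (qform S c).
  by apply: posS; rewrite -normr_gt0 (lt_le_trans ltr01).
move=> w; have [->|w0'] := eqVneq w 0.
  by rewrite normr0 expr0n mulr0 /qform !mul0mx mxE.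
have wp : 0 < `|w| by rewrite normr_gt0.
have wE : w = `|w| *: (`|w|^-1 *: w) by rewrite scalerA divff ?scale1r ?gt_eqF.
rewrite [in leRHS]wE qformZ mulrC ler_pM2l ?exprn_gt0//.
apply: cmin; rewrite inE; split;
  by rewrite /= ?subr0 normrZ normfV normr_id mulVf ?lexx// gt_eqF.
Qed.

End QuadraticForm.

(** * Maps in charts *)

Section Charts.
Context (R : realType) (n : nat).

Lemma nbhs_chart_image (M : topologicalType) (c : chart R n M) x A :
  chart_dom c x -> nbhs x A -> nbhs (c x) (c @` (chart_dom c `&` A)).
Proof.
move=> cx nA.
have img : (c @` chart_dom c) (c x) by exists x.
have nI : nbhs (c x) (c @` chart_dom c).
  by apply: open_nbhs_nbhs; split => //; exact: chart_img_open.
have nA' : nbhs (c x) (chart_inv c @^-1` A).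
  have := @chart_inv_continuous _ _ _ c (c x) (mem_set img); apply.
  by rewrite chart_funK.
apply: filterS2 nI nA' => _ [x' cx' <-]; rewrite /preimage /= chart_funK// => Ax'.
by exists x'.
Qed.

Lemma near_chart (M : topologicalType) (c : chart R n M) x (P : set 'rV[R]_n) :
  chart_dom c x -> nbhs (c x) P -> nbhs x (chart_dom c `&` c @^-1` P).
Proof.
move=> cx nP; apply: filterI.
  by apply: open_nbhs_nbhs; split => //; exact: chart_dom_open.
exact: (@chart_fun_continuous _ _ _ c x (mem_set cx)).
Qed.

Context (M : smoothManifold R n).
Implicit Types (c : chart R n M) (h : M -> M) (x : M).

(** The matrix of the differential of [h] at [x], in the coordinates of [c] at the
    source and of [c'] at the target. *)
Definition chart_jacobian c c' h x := jacobian (c' \o h \o chart_inv c) (c x).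

(** For strict differentiability at one point the chain rule suffices to treat
    composites, whence the iterates of a [C^1] map. *)
Definition C1_at h x := forall c c', atlas c -> atlas c' ->
  chart_dom c x -> chart_dom c' (h x) ->
  strict_diff (c' \o h \o chart_inv c) (c x) (chart_jacobian c c' h x).

Lemma C1_map_C1_at h x : C1_map h -> C1_at h x.
Proof.
move=> [ch hC1] c c' ac ac' cx chx.
apply: (C1_strict_diff _ (hC1 _ _ ac ac')).
apply: nbhs_chart_image => //; apply: ch.
by apply: open_nbhs_nbhs; split => //; exact: chart_dom_open.
Qed.

Lemma C1_at_id x : C1_at id x.
Proof.
move=> c c' ac ac' cx c'x.
apply: (C1_strict_diff _ (atlas_smooth ac ac' 1%N)).
apply: nbhs_chart_image => //.
by apply: open_nbhs_nbhs; split => //; exact: chart_dom_open.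
Qed.

Lemma C1_at_chain c c' c'' h h' x : C1_at h x -> C1_at h' (h x) ->
  {for x, continuous h} -> atlas c -> atlas c' -> atlas c'' ->
  chart_dom c x -> chart_dom c' (h x) -> chart_dom c'' (h' (h x)) ->
  strict_diff (c'' \o (h' \o h) \o chart_inv c) (c x)
    (chart_jacobian c c' h x *m chart_jacobian c' c'' h' (h x)).
Proof.
move=> sh sh' ch ac ac' ac'' cx chx chhx.
apply: (@strict_diff_near _ _ _
  ((c'' \o h' \o chart_inv c') \o (c' \o h \o chart_inv c))); last first.
  apply: strict_diff_comp; first exact: sh.
  by rewrite /= chart_funK//; exact: sh'.
have nh : nbhs x (h @^-1` chart_dom c').
  by apply: ch; apply: open_nbhs_nbhs; split => //; exact: chart_dom_open.
apply: filterS (nbhs_chart_image cx nh) => _ [x' [cx' hx'] <-] /=.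
by rewrite !chart_funK.
Qed.

Lemma C1_at_comp h h' x : C1_at h x -> C1_at h' (h x) ->
  {for x, continuous h} -> C1_at (h' \o h) x.
Proof.
move=> sh sh' ch c c'' ac ac'' cx chx.
have := C1_at_chain sh sh' ch ac (chart_at_atlas (h x)) ac'' cx
  (chart_at_dom (h x)) chx.
by move=> /[dup] /strict_diff_differentiable[_ <-].
Qed.

Lemma chart_jacobian_comp c c' c'' h h' x : C1_at h x -> C1_at h' (h x) ->
  {for x, continuous h} -> atlas c -> atlas c' -> atlas c'' ->
  chart_dom c x -> chart_dom c' (h x) -> chart_dom c'' (h' (h x)) ->
  chart_jacobian c c'' (h' \o h) x =
  chart_jacobian c c' h x *m chart_jacobian c' c'' h' (h x).
Proof.
move=> sh sh' ch ac ac' ac'' cx chx chhx.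
by have [_] := strict_diff_differentiable
  (C1_at_chain sh sh' ch ac ac' ac'' cx chx chhx).
Qed.

Lemma chart_jacobian_id c x : chart_dom c x -> chart_jacobian c c id x = 1%:M.
Proof.
move=> cx; suff : strict_diff (c \o id \o chart_inv c) (c x) 1%:M.
  by move=> /strict_diff_differentiable[].
apply: (@strict_diff_near _ _ _ id).
  have nT : nbhs x [set: M] by exact: filterT.
  apply: filterS (nbhs_chart_image cx nT) => _ [x' [cx' _] <-] /=.
  by rewrite chart_funK.
move=> e e0; exists 1 => // y z _ _; rewrite mulmx1 subrr normr0.
by rewrite mulr_ge0// ltW.
Qed.

Lemma C1_map_iter h m : C1_map h -> continuous (iter m h) /\
  forall x, C1_at (iter m h) x.
Proof.
move=> C1h; have ch := C1h.1; elim: m => [|m [cm IH]]; split.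
- by move=> x; exact: cvg_id.
- exact: C1_at_id.
- by move=> x; apply: (@continuous_comp _ _ _ (iter m h) h); [exact: cm|exact: ch].
- move=> x; apply: (@C1_at_comp (iter m h) h); first exact: IH.
    exact: C1_map_C1_at.
  exact: cm.
Qed.

End Charts.

(** * The Riemannian norm in charts *)

Section RiemannianCharts.
Context (R : realType) (n : nat) (M : riemannianManifold R n).
Implicit Types (c : chart R n M) (x : M).

(** The Riemannian norm of the tangent vector at [x] whose coordinates in [c] are
    [w]. *)
Definition coord_norm c x (w : 'rV[R]_n) : R :=
  @tangent_norm R n M x (w *m chart_jacobian c (chart_at x) id x).

(** The Gram matrix of the metric in the coordinates of [c]. *)
Definition metric_coord c (y : 'rV[R]_n) : 'M[R]_n :=
  let x := chart_inv c y in
  let J := jacobian (chart_at x \o chart_inv c) y in J *m metric x *m J^T.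

Lemma coord_normE c x w : chart_dom c x ->
  coord_norm c x w = Num.sqrt (qform (metric_coord c (c x)) w).
Proof.
move=> cx; rewrite /coord_norm /tangent_norm /metric_coord /qform chart_funK//.
by rewrite trmx_mul !mulmxA.
Qed.

Lemma metric_coord_center x : metric_coord (chart_at x) (chart_at x x) = metric x.
Proof.
rewrite /metric_coord chart_funK; last exact: chart_at_dom.
have := chart_jacobian_id (chart_at_dom x); rewrite /chart_jacobian => JE.
by rewrite -[chart_at x \o chart_inv _]/(chart_at x \o id \o chart_inv _) JE
  mul1mx trmx1 mulmx1.
Qed.

(** At [x0] the Gram matrix in the chart around [x0] is the positive definite matrix
    [metric x0], and it depends continuously on the point. *)
Lemma near_metric_bound x0 : exists k : R, 0 < k /\
  \forall x \near x0, chart_dom (chart_at x0) x /\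
    forall w, `|w| ^+ 2 <= k * qform (metric_coord (chart_at x0) (chart_at x0 x)) w
    /\ qform (metric_coord (chart_at x0) (chart_at x0 x)) w <= k * `|w| ^+ 2.
Proof.
set c := chart_at x0; set G := metric_coord c.
have cx0 : chart_dom c x0 by exact: chart_at_dom.
have [b b0 bP] : exists2 b : R, 0 < b &
    forall w, b * `|w| ^+ 2 <= qform (G (c x0)) w.
  by apply: pos_qform_bound => w w0; rewrite /G metric_coord_center; exact: metric_pos.
pose e : R := b / (2 * (n%:R ^+ 2 + 1)).
have n2 : 0 < n%:R ^+ 2 + 1 :> R by rewrite ltr_wpDl// exprn_ge0.
have e0 : 0 < e by rewrite divr_gt0// mulr_gt0.
have cG : {for c x0, continuous G}.
  have := @metric_smooth R n M c (chart_at_atlas x0) 0%N.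
  by apply; rewrite inE; exists x0.
clearbody G.
have nG : nbhs (c x0) [set y | `|G (c x0) - G y| <= e].
  by move/(@cvgrPdist_le _ _ _ (nbhs (c x0))) : cG => /(_ _ e0).
pose B := n%:R ^+ 2 * `|G (c x0)|.
have B0 : 0 <= B by rewrite mulr_ge0// exprn_ge0.
exists (2 / b + (B + b)); split.
  by rewrite addr_gt0 ?divr_gt0// ltr_wpDl.
apply: filterS (near_chart cx0 nG) => x [cx xe]; split => // w.
have qd : `|qform (G (c x)) w - qform (G (c x0)) w| <= b / 2 * `|w| ^+ 2.
  rewrite qformB; apply: le_trans (qform_bound _ _) _.
  rewrite ler_wpM2r ?exprn_ge0//.
  apply: (@le_trans _ _ (n%:R ^+ 2 * e)).
    by rewrite ler_wpM2l// ?exprn_ge0// distrC.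
  have -> : b / 2 = (n%:R ^+ 2 + 1) * e by rewrite /e; field; rewrite gt_eqF.
  by rewrite ler_pM2r// lerDl.
have q0 := qform_bound (G (c x0)) w; rewrite -/B in q0.
have w2 : 0 <= `|w| ^+ 2 by rewrite exprn_ge0.
have low := bP w.
have q0' : qform (G (c x0)) w <= B * `|w| ^+ 2 := le_trans (ler_norm _) q0.
move: qd; rewrite ler_distl => /andP[qd1 qd2].
have qlow : b / 2 * `|w| ^+ 2 <= qform (G (c x)) w by lra.
split; last first.
  have : 0 <= 2 / b * `|w| ^+ 2 by rewrite mulr_ge0// divr_ge0// ltW.
  have : 0 <= b * `|w| ^+ 2 by rewrite mulr_ge0// ltW.
  lra.
have : `|w| ^+ 2 = 2 / b * (b / 2 * `|w| ^+ 2) by field; rewrite gt_eqF.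
have : 2 / b * (b / 2 * `|w| ^+ 2) <= 2 / b * qform (G (c x)) w.
  by rewrite ler_wpM2l// divr_ge0// ltW.
have q_ge0 : 0 <= qform (G (c x)) w.
  by apply: le_trans qlow; rewrite mulr_ge0// divr_ge0// ltW.
have : 0 <= (B + b) * qform (G (c x)) w.
  by rewrite mulr_ge0// addr_ge0// ltW.
lra.
Qed.

(** The three bounds share one natural number, and get weaker as it grows, so that
    finitely many charts can be controlled by the same one. *)
Definition chart_control c (N : set M) (k : nat) :=
  (forall x w, N x -> `|w| <= k%:R * coord_norm c x w /\
                      coord_norm c x w <= k%:R * `|w|) /\
  (forall y z, N y -> N z -> `|c y - c z| <= k%:R).

Lemma coord_norm_ge0 c x w : 0 <= coord_norm c x w.
Proof. exact: sqrtr_ge0. Qed.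

Lemma chart_control_le c N k l : (k <= l)%N ->
  chart_control c N k -> chart_control c N l.
Proof.
move=> kl [h1 h2]; have kl' : k%:R <= l%:R :> R by rewrite ler_nat.
split=> [x w Nx|y z Ny Nz]; last exact: le_trans (h2 _ _ Ny Nz) kl'.
have [h3 h4] := h1 x w Nx; split.
  by apply: le_trans h3 _; rewrite ler_wpM2r// coord_norm_ge0.
by apply: le_trans h4 _; rewrite ler_wpM2r.
Qed.

(** The neighborhood is the image of a closed coordinate ball, so that it is closed:
    points near a point outside it are outside it too. *)
Lemma exists_controlled_nbhs x0 : exists N,
  [/\ closed N, nbhs x0 N, N `<=` chart_dom (chart_at x0) &
    exists k, chart_control (chart_at x0) N k].
Proof.
have [k [k0 kP]] := near_metric_bound x0.
set c := chart_at x0 in kP *.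
have cx0 : chart_dom c x0 by exact: chart_at_dom.
have /nbhs_ballP[r /= r0 rP] := nbhs_chart_image cx0 kP.
pose D := [set y : 'rV[R]_n | `|y - c x0| <= r / 2].
have r2 : 0 < r / 2 by rewrite divr_gt0.
have DP y : D y -> exists2 x, y = c x & chart_dom c x /\
  forall w, `|w| ^+ 2 <= k * qform (metric_coord c (c x)) w
    /\ qform (metric_coord c (c x)) w <= k * `|w| ^+ 2.
  move=> Dy; have [|x [_ [cx xP]] xy] := rP y; last by exists x.
  by rewrite -ball_normE /= distrC; apply: le_lt_trans Dy _; lra.
have nD : nbhs (c x0) D.
  apply/nbhs_ballP; exists (r / 2) => //= y.
  by rewrite -ball_normE /= distrC => /ltW.
exists (chart_inv c @` D); split.
- apply: compact_closed; first exact: manifold_hausdorff.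
  apply: continuous_compact; last exact: closed_ball_rV_compact.
  apply: continuous_in_subspaceT => y; rewrite inE => /DP[x -> [cx _]].
  by apply: (@chart_inv_continuous _ _ _ c); rewrite inE; exists x.
- apply: filterS (near_chart cx0 nD) => x [cx Dx].
  by exists (c x) => //; rewrite chart_funK.
- by move=> _ [y /DP[x -> [cx _]] <-]; rewrite chart_funK.
- pose l := (Num.truncn (k + r + 1)).+1.
  have kl : k + r + 1 <= l%:R by exact: ltW (truncnS_gt _).
  have k_le : k <= l%:R ^+ 2.
    have : 1 * k <= l%:R * l%:R by rewrite ler_pM//; lra.
    by rewrite mul1r expr2.
  exists l; split; last first.
    move=> _ _ [y Dy <-] [z Dz <-].
    have [x' xy _] := DP _ Dy; have [x'' xz _] := DP _ Dz.
    have cK (u : M) y' : y' = c u -> D y' -> c (chart_inv c y') = y'.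
      by move=> _ /DP[v -> [cv _]]; rewrite chart_funK.
    rewrite (cK _ _ xy Dy) (cK _ _ xz Dz).
    have := ler_distD (c x0) y z; rewrite [`|c x0 - z|]distrC.
    move: Dy Dz; rewrite /D /=; lra.
  move=> _ w [y /DP[x -> [cx xP]] <-]; rewrite chart_funK//.
  rewrite coord_normE//; set q := qform _ _.
  have [q1 q2] := xP w; rewrite -/q in q1 q2.
  have q0 : 0 <= q by rewrite -(pmulr_rge0 _ k0); apply: le_trans q1; rewrite exprn_ge0.
  have l0 : 0 <= l%:R :> R by [].
  split.
    rewrite -(@ler_pXn2r _ 2) ?nnegrE ?mulr_ge0 ?sqrtr_ge0//.
    rewrite exprMn sqr_sqrtr//; apply: le_trans q1 _.
    by rewrite ler_wpM2r.
  rewrite -(@ler_pXn2r _ 2) ?nnegrE ?mulr_ge0 ?sqrtr_ge0//.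
  rewrite exprMn sqr_sqrtr//; apply: le_trans q2 _.
  by rewrite ler_wpM2r// exprn_ge0.
Qed.

End RiemannianCharts.

(** * Differentiable expanding sets *)

Lemma filter_forall_seq (I : eqType) (s : seq I) (T : Type) (F : set_system T)
    (FF : Filter F) (Q : I -> set T) :
  (forall a, a \in s -> F (Q a)) -> F [set t | forall a, a \in s -> Q a t].
Proof.
elim: s => [_|a s IH h]; first by apply: filterS filterT => t _ a.
have hs : F [set t | forall a, a \in s -> Q a t].
  by apply: IH => b bs; apply: h; rewrite inE bs orbT.
apply: filterS2 (h a (mem_head _ _)) hs => t Qa Qs b.
by rewrite inE => /orP[/eqP ->|/Qs].
Qed.

Section ExpandingSets.
Context (R : realType) (n : nat) (M : riemannianManifold R n) (f : M -> M).
Context (K : set M) (C lambda : R).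
Hypothesis C1f : C1_map f.
Hypothesis C0 : 0 < C.
Hypothesis lambda1 : 1 < lambda.
Hypothesis expf : forall (x : M) (v : tangent x) (m : nat), K x -> (0 < m)%N ->
  C * lambda ^+ m * tangent_norm v <= tangent_norm (tangent_map (iter m f) v).

(** The expansion hypothesis is about the charts [chart_at]; the chain rule carries
    it to all charts, as changes of charts preserve the Riemannian norm. *)
Lemma coord_norm_expand m x (c c' : chart R n M) w : K x -> (0 < m)%N ->
  atlas c -> atlas c' -> chart_dom c x -> chart_dom c' (iter m f x) ->
  C * lambda ^+ m * coord_norm c x w <=
  coord_norm c' (iter m f x) (w *m chart_jacobian c c' (iter m f) x).
Proof.
move=> Kx m0 ac ac' cx c'x.
have [cg C1g] := C1_map_iter m C1f.
set g := iter m f in cg C1g c'x *.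
have agx := chart_at_atlas (g x); have dgx := chart_at_dom (g x).
have ax := chart_at_atlas x; have dx := chart_at_dom x.
rewrite /coord_norm -mulmxA.
rewrite -(@chart_jacobian_comp R n M c c' (chart_at (g x)) g id x)//; first last.
- exact: cg.
- exact: C1_at_id.
have -> : chart_jacobian c (chart_at (g x)) (id \o g) x =
    chart_jacobian c (chart_at x) id x *m
    chart_jacobian (chart_at x) (chart_at (g x)) g x.
  rewrite -(@chart_jacobian_comp R n M c (chart_at x) (chart_at (g x)) id g x)//.
  exact: C1_at_id.
rewrite mulmxA; exact: expf.
Qed.

(** When [x] or its image is outside the closed set [N] or [N'], the premises fail
    near [(x, x)].  Otherwise the differential in the charts [c] and [c'] expands
    the coordinate norm by at least [3], and strict differentiability leaves [2] for
    nearby pairs. *)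
Lemma near_pair_expansion m k (c c' : chart R n M) (N N' : set M) x :
  K x -> (0 < m)%N -> 3 * (k%:R ^+ 2 + 1) < C * lambda ^+ m ->
  atlas c -> atlas c' -> closed N -> closed N' ->
  N `<=` chart_dom c -> N' `<=` chart_dom c' ->
  chart_control c N k -> chart_control c' N' k ->
  nbhs (x, x) [set p | N p.1 -> N p.2 -> N' (iter m f p.1) ->
    N' (iter m f p.2) ->
    2 * `|c p.1 - c p.2| <= `|c' (iter m f p.1) - c' (iter m f p.2)|].
Proof.
move=> Kx m0 km ac ac' clN clN' Nc N'c' [cN _] [cN' _].
have [cg C1g] := C1_map_iter m C1f.
have nNC : ~ N x -> nbhs x (~` N).
  by move=> ?; apply: open_nbhs_nbhs; split => //; exact: closed_openC.
have nN'C : ~ N' (iter m f x) -> nbhs x (iter m f @^-1` (~` N')).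
  move=> ?; apply: cg.
  by apply: open_nbhs_nbhs; split => //; exact: closed_openC.
have [Nx|/nNC nN] := pselect (N x); last first.
  by exists (~` N, setT) => /=; [split => //; exact: filterT|move=> [y z] [/= ? _]].
have [N'x|/nN'C nN'] := pselect (N' (iter m f x)); last first.
  exists (iter m f @^-1` (~` N'), setT) => /=; first by split => //; exact: filterT.
  by move=> [y z] [/= ? _].
have cx := Nc _ Nx; have c'x := N'c' _ N'x.
set D := chart_jacobian c c' (iter m f) x.
have Dexp (w : 'rV[R]_n) : 3 * `|w| <= `|w *m D|.
  have [h1 _] := cN x w Nx.
  have [_ h2] := cN' (iter m f x) (w *m D) N'x.
  have h3 := coord_norm_expand w Kx m0 ac ac' cx c'x; rewrite -/D in h3.
  have Cl : 0 < C * lambda ^+ m.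
    by apply: lt_trans km; rewrite mulr_gt0// ltr_wpDl// exprn_ge0.
  have h4 : C * lambda ^+ m * `|w| <= k%:R ^+ 2 * `|w *m D|.
    apply: le_trans (ler_wpM2l (ltW Cl) h1) _.
    rewrite mulrCA expr2 -mulrA ler_wpM2l//.
    exact: le_trans h3 h2.
  have h5 : 3 * (k%:R ^+ 2 + 1) * `|w| <= C * lambda ^+ m * `|w|.
    by rewrite ler_wpM2r// ltW.
  have k1 : 0 < k%:R ^+ 2 + 1 :> R by rewrite ltr_wpDl// exprn_ge0.
  rewrite -(ler_pM2l k1) mulrA [_ * 3]mulrC.
  apply: le_trans h5 _; apply: le_trans h4 _.
  by rewrite ler_wpM2r// lerDl.
have [|d d0 dP] := strict_diff_expand (C1g x c c' ac ac' cx c'x) Dexp (l := 2).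
  by rewrite ltr_nat.
have nd : nbhs (c x) [set y | `|y - c x| < d].
  apply/nbhs_ballP; exists d => //= y.
  by rewrite -ball_normE /= distrC.
have ncd := near_chart cx nd.
exists (chart_dom c `&` c @^-1` [set y | `|y - c x| < d],
        chart_dom c `&` c @^-1` [set y | `|y - c x| < d]) => //=.
move=> [y z] /= [[cy yd] [cz zd]] _ _ _ _.
by have := dP _ _ yd zd; rewrite /= !chart_funK.
Qed.

(** The pairs in [W] are in a common chart and have their distance doubled by
    [iter m f].  For a pair whose iterates all stay in [W], the distances at
    the multiples of [m], read in possibly varying charts, double at each step and
    stay bounded, so they vanish. *)
Lemma exists_expansive_nbhs : compact K -> exists W : set (M * M),
  (forall x, K x -> nbhs (x, x) W) /\
  (forall y z, K y -> K z -> (forall j, W (iter j f y, iter j f z)) -> y = z).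
Proof.
move=> cK.
have /choice[N NP] := @exists_controlled_nbhs R n M.
have nN x : nbhs x ((N x)°).
  by apply: nbhs_interior; have [] := NP x.
have [s sP] := compact_finite_nbhs_cover cK nN.
have [k kP] : exists k, forall a, a \in s -> chart_control (chart_at a) (N a) k.
  apply: seq_uniform_bound => [a i j ij|a _]; first exact: chart_control_le.
  by have [] := NP a.
have [m m0 mP] := power_unbounded (3 * (k%:R ^+ 2 + 1) / C) lambda1.
have {}mP : 3 * (k%:R ^+ 2 + 1) < C * lambda ^+ m.
  by move: mP; rewrite ltr_pdivrMr// [_ * C]mulrC.
pose g := iter m f.
pose Q a b := [set p : M * M | N a p.1 -> N a p.2 -> N b (g p.1) -> N b (g p.2) ->
  2 * `|chart_at a p.1 - chart_at a p.2| <=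
  `|chart_at b (g p.1) - chart_at b (g p.2)|].
pose W0 := [set p : M * M | exists2 a, a \in s & N a p.1 /\ N a p.2].
exists (W0 `&` [set p | forall a, a \in s -> forall b, b \in s -> Q a b p]); split.
  move=> x Kx; apply: filterI.
    have [a sa Nax] := sP x Kx.
    by exists (N a, N a) => // -[y z] [/= ? ?]; exists a.
  apply: filter_forall_seq => a sa; apply: filter_forall_seq => b sb.
  have [? _ ? _] := NP a; have [? _ ? _] := NP b.
  by apply: (@near_pair_expansion m k) => //; [exact: chart_at_atlas|
    exact: chart_at_atlas|exact: kP|exact: kP].
move=> y z Ky Kz yz.
pose u j := iter (j * m) f y; pose v j := iter (j * m) f z.
have uS j : u j.+1 = g (u j) by rewrite /u /g -iterD mulSn.
have vS j : v j.+1 = g (v j) by rewrite /v /g -iterD mulSn.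
have /choice[i iP] j : exists a, [/\ a \in s, N a (u j) & N a (v j)].
  by have [[a sa [? ?]] _] := yz (j * m)%N; exists a.
pose t j := `|chart_at (i j) (u j) - chart_at (i j) (v j)|.
have tS j : 2 * t j <= t j.+1.
  have [_ h] := yz (j * m)%N; rewrite /t uS vS.
  have [sj uj vj] := iP j; have [sj' uj' vj'] := iP j.+1.
  by apply: h => //=; rewrite -?uS -?vS.
have tk j : t j <= k%:R.
  by have [sj uj vj] := iP j; have [_ h] := kP _ sj; exact: h.
have t2 j : 2 ^+ j * t 0%N <= t j.
  elim: j => [|j IH]; first by rewrite expr0 mul1r.
  rewrite exprS -mulrA; apply: le_trans (tS j); rewrite ler_wpM2l//.
have t0 : t 0%N = 0.
  apply/eqP; rewrite eq_le normr_ge0 andbT leNgt; apply/negP => tpos.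
  have [j _] := @power_unbounded R 2 (k%:R / t 0%N) (ltr1n _ _).
  rewrite ltr_pdivrMr// ltNge => /negP; apply.
  exact: le_trans (t2 j) (tk j).
have [s0 u0 v0] := iP 0%N.
have [_ _ Nd _] := NP (i 0%N).
have e : chart_at (i 0%N) y = chart_at (i 0%N) z.
  by apply/subr0_eq/eqP; rewrite -normr_eq0; apply/eqP; exact: t0.
rewrite -[y](@chart_funK _ _ _ (chart_at (i 0%N))); last exact: Nd.
by rewrite e chart_funK//; exact: Nd.
Qed.

Lemma tangent_norm0 (x : M) : @tangent_norm R n M x (0 : 'rV[R]_n) = 0.
Proof. by rewrite /tangent_norm !mul0mx mxE sqrtr0. Qed.

Lemma tangent_norm_gt0 (x : M) (v : 'rV[R]_n) : v != 0 ->
  0 < @tangent_norm R n M x v.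
Proof. by move=> v0; rewrite sqrtr_gt0; exact: metric_pos. Qed.

Lemma expanding_tangent_map_unit x : K x -> tangent_map_mx f x \in unitmx.
Proof.
move=> Kx; rewrite -row_free_unit -kermx_eq0; apply/rowV0P => v.
move=> /sub_kermxP vT; apply/eqP; apply: contraT => v0.
have := @expf x v 1%N Kx (ltn0Sn 0).
have -> : @tangent_map R n M (iter 1 f) x v = 0 :> 'rV[R]_n by exact: vT.
rewrite [X in _ <= X -> _](tangent_norm0 (f x)).
by rewrite leNgt mulr_gt0 ?tangent_norm_gt0// mulr_gt0// exprn_gt0// (lt_trans ltr01).
Qed.

(** Only the case [m = 1] of the expansion hypothesis matters here: it makes the
    differential injective, hence invertible. *)
Lemma expanding_open x A : K x -> nbhs x A -> nbhs (f x) (f @` A).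
Proof.
move=> Kx nA; set c := chart_at x; set c' := chart_at (f x).
have cx : chart_dom c x := chart_at_dom x.
have c'x : chart_dom c' (f x) := chart_at_dom (f x).
have cf := C1f.1.
have sF := C1_map_C1_at (x := x) C1f (chart_at_atlas x) (chart_at_atlas (f x)) cx c'x.
have nA' : nbhs x (A `&` f @^-1` chart_dom c').
  apply: filterI => //; apply: cf.
  by apply: open_nbhs_nbhs; split => //; exact: chart_dom_open.
have := strict_diff_open sF (expanding_tangent_map_unit Kx) (nbhs_chart_image cx nA').
rewrite /= chart_funK// => /(near_chart c'x).
apply: filterS => u [c'u [_ [x' [cx' [Ax' c'x']] <-]]].
rewrite /= chart_funK// => e; exists x' => //.
by rewrite -[f x'](@chart_funK _ _ _ c')// e chart_funK.
Qed.

Lemma Re_sum (I : Type) (r : seq I) (F : I -> R[i]) :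
  complex.Re (\sum_(i <- r) F i) = \sum_(i <- r) complex.Re (F i).
Proof. by apply: (big_morph (@complex.Re R)) => // -[? ?] [? ?]. Qed.

Lemma Re_mulmx (v : 'rV[R[i]]_n) (A : 'M[R]_n) :
  map_mx (@complex.Re R) (v *m map_mx (real_complex R) A) = map_mx (@complex.Re R) v *m A.
Proof.
apply/rowP => j; rewrite !mxE Re_sum; apply: eq_bigr => l _; rewrite !mxE.
by case: (v 0 l) => a b /=; rewrite mulr0 subr0.
Qed.

(** If an eigenvalue of the differential of [iter k f] at [p] has modulus at most
    [1], the iterates of an eigenvector under this real matrix are bounded, and so
    are those of its real part.  As the powers of the matrix expand real vectors
    exponentially, the real part is zero.  The same holds for all multiples of the
    eigenvector, so it is zero. *)
Lemma periodic_repelling p k : K p -> (0 < k)%N -> iter k f p = p ->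
  linear_expanding (tangent_map_mx (iter k f) p).
Proof.
move=> Kp k0 pk a ev.
set c := chart_at p.
have cp : chart_dom c p := chart_at_dom p.
have ac : atlas c := chart_at_atlas p.
have pkj j : iter (k * j) f p = p := iter_period 0 j pk.
pose U j := chart_jacobian c c (iter (k * j) f) p.
have TU : tangent_map_mx (iter k f) p = U 1%N.
  by rewrite /tangent_map_mx /U /chart_jacobian muln1 pk.
have jcomp (g h : M -> M) : C1_at g p -> C1_at h p -> {for p, continuous g} ->
    g p = p -> h p = p ->
    chart_jacobian c c (h \o g) p = chart_jacobian c c g p *m chart_jacobian c c h p.
  move=> sg sh cg gp hp.
  have := @chart_jacobian_comp R n M c c c g h p sg; rewrite gp hp => E.
  exact: (E sh cg ac ac ac cp cp cp).
have US j : U j.+1 = U j *m U 1%N.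
  have iterE : iter (k * j.+1) f = iter (k * 1) f \o iter (k * j) f.
    by apply/funext => x; rewrite /= -iterD -mulnDr add1n.
  have [cj C1j] := C1_map_iter (k * j) C1f.
  have [c1 C11] := C1_map_iter (k * 1) C1f.
  rewrite {1}/U iterE.
  exact: (jcomp _ _ (C1j p) (C11 p) (cj p) (pkj j) (pkj 1%N)).
have growth j (w : 'rV[R]_n) : (0 < j)%N ->
    C * lambda ^+ (k * j) * @tangent_norm R n M p w <= @tangent_norm R n M p (w *m U j).
  move=> j0; have kj : (0 < k * j)%N by rewrite muln_gt0 k0.
  have cpj : chart_dom c (iter (k * j) f p) by rewrite pkj.
  have := coord_norm_expand w Kp kj ac ac cp cpj.
  by rewrite /coord_norm pkj !(chart_jacobian_id cp) !mulmx1.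
have U0 : U 0%N = 1%:M by rewrite /U muln0; exact: chart_jacobian_id.
clearbody U.
have [B normB] : exists B : nat, forall w : 'rV[R]_n,
    @tangent_norm R n M p w <= B%:R * `|w|.
  have [N [_ nN _ [B [hB _]]]] := exists_controlled_nbhs p.
  exists B => w; have [_] := hB p w (nbhs_singleton nN).
  by rewrite /coord_norm (chart_jacobian_id cp) mulmx1.
have bounded0 (u : 'rV[R]_n) (b : R) : (forall j, `|u *m U j| <= b) -> u = 0.
  move=> ub; apply/eqP; apply: contraT => u0.
  have tu := tangent_norm_gt0 p u0.
  have Ct : 0 < C * @tangent_norm R n M p u by rewrite mulr_gt0.
  have [j j0 jP] := power_unbounded (B%:R * b / (C * @tangent_norm R n M p u)) lambda1.
  have := growth j u j0; rewrite leNgt => /negP; case.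
  apply: le_lt_trans (normB _) _.
  apply: (@le_lt_trans _ _ (B%:R * b)); first by rewrite ler_wpM2l.
  move: jP; rewrite ltr_pdivrMr// => /lt_le_trans; apply.
  rewrite mulrCA mulrA ler_pM2r// ler_pM2l//.
  by rewrite ler_weXn2l ?ltW// leq_pmull.
have [v vE v0] := eigenvalueP ev; rewrite TU in vE.
rewrite real_ltNge ?real1 ?normr_real//; apply/negP => a1.
have eig (w : 'rV[R[i]]_n) j : w *m map_mx (real_complex R) (U 1%N) = a *: w ->
    w *m map_mx (real_complex R) (U j) = a ^+ j *: w.
  move=> wE; elim: j => [|j IH].
    by rewrite U0 map_mx1 mulmx1 expr0 scale1r.
  by rewrite US map_mxM mulmxA IH -scalemxAl wE scalerA exprSr.
have Re0 (w : 'rV[R[i]]_n) : w *m map_mx (real_complex R) (U 1%N) = a *: w ->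
    map_mx (@complex.Re R) w = 0.
  move=> wE; apply: (bounded0 _ (\sum_l complex.Re `|w 0 l|)) => j.
  rewrite -Re_mulmx eig//.
  have Wl l : real_complex R (complex.Re `|w 0 l|) = `|w 0 l|.
    by rewrite RRe_real// normr_real.
  have Wl0 l : 0 <= complex.Re `|w 0 l|.
    by rewrite -lecR /= Wl normr_ge0.
  apply: mx_norm_le_entries => [|i l]; first by rewrite sumr_ge0.
  have : real_complex R `|complex.Re (a ^+ j * w 0 l)| <=
      real_complex R (complex.Re `|w 0 l|).
    rewrite Wl; apply: le_trans (normc_ge_Re _) _.
    by rewrite normrM normrX ler_piMl// exprn_ile1.
  rewrite lecR => h; rewrite ord1 !mxE; apply: le_trans h _.
  rewrite (bigD1 l)//=; apply: ler_wpDr => //.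
  by apply: sumr_ge0 => l' _; exact: Wl0.
(* the imaginary part of [v] is the real part of the eigenvector [- i v] *)
have Im0 : map_mx (@complex.Re R) ((Complex 0 (-1)) *: v) = 0.
  by apply: Re0; rewrite -scalemxAl vE !scalerA mulrC.
have := Re0 v vE => /rowP Re0v; move/rowP : Im0 => Im0v.
move/eqP: v0; apply; apply/rowP => l.
move: (Re0v l) (Im0v l); rewrite !mxE; case: (v 0 l) => x y /=.
by rewrite mul0r mulN1r opprK add0r => -> ->.
Qed.

End ExpandingSets.

(** * Subspaces and homoclinic orbits *)

Section Subtype.
Context (M : topologicalType) (K : set M).

Lemma nbhs_subtypeP (x : K) (B : set K) :
  nbhs x B <-> exists2 V, nbhs (set_val x) V & set_val @^-1` V `<=` B.
Proof.
split.
  case=> _ /= [] [W oW <- /= Wx sWB]; exists W => //.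
  exact: open_nbhs_nbhs.
move=> [V nV VB]; apply: filterS VB _.
by apply: (@initial_continuous K M set_val x); exact: nV.
Qed.

Lemma subtype_hausdorff : hausdorff_space M -> hausdorff_space K.
Proof.
move=> hM x y xy; apply: val_inj; apply: hM => A B nA nB.
have [||z [Az Bz]] := xy (set_val @^-1` A) (set_val @^-1` B).
- by apply/nbhs_subtypeP; exists A.
- by apply/nbhs_subtypeP; exists B.
by exists (set_val z).
Qed.

Lemma subtype_compact : compact K -> compact [set: K].
Proof.
move=> cK F PF _.
have [|p [Kp clp]] := cK (set_val @ F) _.
  by apply: (@filterS _ F _ setT) => [x _|]; [exact: set_valP|exact: filterT].
exists (exist _ p (mem_set Kp)); split => // A B FA /nbhs_subtypeP[V nV VB].
have [|_ [[a Aa <-] Va]] := clp (set_val @` A) V _ nV.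
  by apply: (@filterS _ F _ A) => // a Aa; exists a.
by exists a; split => //; exact: VB.
Qed.

Lemma subtype_uncountable : ~ countable K -> ~ countable [set: K].
Proof.
move=> unK cK; apply: unK; apply: sub_countable cK.
have vK : set_val @` [set: K] = K.
  apply/seteqP; split=> [_ [x _ <-]|x Kx]; first exact: set_valP.
  by exists (exist _ x (mem_set Kx)).
by have := card_image_le (@set_val M K) [set: K]; rewrite vK.
Qed.

Context (f : M -> M) (fK : forall x, K x -> K (f x)).

Definition subtype_map (x : K) : K := exist _ (f (set_val x)) (mem_set (fK (set_valP x))).

Local Notation fX := subtype_map.

Lemma subtype_map_iter m x : set_val (iter m fX x) = iter m f (set_val x).
Proof. by elim: m => //= m <-. Qed.

Lemma subtype_map_continuous : continuous f -> continuous fX.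
Proof.
move=> cf x B /nbhs_subtypeP[V nV VB]; apply/nbhs_subtypeP.
exists (f @^-1` V); first exact: cf.
by move=> y Vy; exact: VB.
Qed.

Lemma cycle_set_subtype p m w :
  cycle_set f (set_val p) m (set_val w) <-> cycle_set fX p m w.
Proof.
split=> -[j jm e]; exists j => //; last by rewrite -subtype_map_iter e.
have e' : set_val (iter j fX p) = set_val w by rewrite subtype_map_iter.
exact: val_inj e'.
Qed.

Lemma cycle_set_sub (p : K) m : cycle_set f (set_val p) m `<=` K.
Proof. by move=> _ [j _ <-]; rewrite -subtype_map_iter; exact: set_valP. Qed.

Lemma converges_subtype (u : nat -> K) p m :
  converges_to_set u (cycle_set fX p m) ->
  converges_to_set (fun i => set_val (u i)) (cycle_set f (set_val p) m).
Proof.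
move=> cu U nU; apply: (cu (set_val @^-1` U)) => q [j jm <-].
apply/nbhs_subtypeP; exists U => //; apply: nU.
by exists j; rewrite ?subtype_map_iter.
Qed.

Lemma preorbit_subtype (u : nat -> K) w : preorbit fX w u ->
  preorbit f (set_val w) (fun i => set_val (u i)).
Proof. by move=> [<- h]; split => // i; rewrite -(h i). Qed.

Lemma unstable_set_subtype p m w : unstable_set fX (cycle_set fX p m) w ->
  unstable_set f (cycle_set f (set_val p) m) (set_val w).
Proof.
move=> [u pu cu]; exists (fun i => set_val (u i)); first exact: preorbit_subtype.
exact: converges_subtype.
Qed.

End Subtype.

(** Nonnegative indices run backwards in time along the preorbit, negative ones
    along the future orbit. *)
Lemma homoclinic_of_unstable (T : topologicalType) (f : T -> T) (gamma : set T)
    w N (u : nat -> T) : preorbit f w u -> converges_to_set u gamma ->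
  (forall i, (N <= i)%N -> gamma (iter i f w)) -> ~ gamma w ->
  homoclinic_orbit f gamma
    (fun z => match z with Posz i => u i | Negz j => iter j.+1 f w end).
Proof.
move=> [u0 fu] cu gw ngw; split.
- move=> [i|[|j]]; first by rewrite -PoszD addn1 fu.
    by rewrite /= u0.
  have -> : Negz j.+1 + 1 = Negz j by lia.
  by [].
- exact: cu.
- move=> U nU; exists N.+1 => // -[//|i] /= Ni.
  by apply: nbhs_singleton; apply: nU; apply: (gw i.+1); exact: ltnW.
- by move=> sub; apply: ngw; apply: sub; exists (Posz 0).
Qed.

Theorem theorem1 (R : realType) (n : nat) (M : riemannianManifold R n)
    (f : M -> M) (K : set M) (hf : C1_map f) (hK : expanding_set f K)
    (hunc : ~ countable K) :
  (exists gamma : set M, [/\ periodic_repellor f gamma, gamma `<=` K &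
     exists2 x : int -> M, range x `<=` K & homoclinic_orbit f gamma x]) /\
  (transitive_set f K ->
   forall gamma : set M, periodic_orbit f gamma -> gamma `<=` K ->
     K = closure (iterated_preimages f gamma `&` unstable_set f gamma `&` K) /\
     K `<=` homoclinic_class f gamma).
Proof.
have [cK [C [lambda [C0 lambda1 expf]]] [U KU KE]] := hK.
have fK x : K x -> K (f x).
  by rewrite {1}KE KE => Kx m _; have := Kx m.+1 I; rewrite /preimage /= -iterS iterSr.
(* isolation turns openness of [f] in [M] into openness of its restriction to [K] *)
have isoK y : U y -> K (f y) -> K y.
  move=> Uy; rewrite KE => Kfy [|m] _ //.
  by have := Kfy m I; rewrite /preimage /= -iterSr.
have [W [nW expW]] := exists_expansive_nbhs hf C0 lambda1 expf cK.
pose fX := subtype_map fK.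
have valX m x : set_val (iter m fX x) = iter m f (set_val x).
  exact: subtype_map_iter.
have cX := subtype_compact cK.
have hX : hausdorff_space K := subtype_hausdorff (@manifold_hausdorff _ _ M).
have cfX : continuous fX by apply: subtype_map_continuous; exact: hf.1.
have openX (x : K) A : nbhs x A -> nbhs (fX x) (fX @` A).
  move=> /nbhs_subtypeP[V nV VA]; apply/nbhs_subtypeP.
  exists (f @` (V `&` U)).
    apply: (expanding_open hf C0 lambda1 expf (set_valP x)).
    by apply: filterI => //; exact: KU (set_valP x).
  move=> y [v [Vv Uv] vy].
  have Kv : K v by apply: isoK => //; rewrite vy; exact: set_valP.
  exists (exist _ v (mem_set Kv)); first exact: VA.
  by apply: val_inj.
have [E [clE nE symE EW]] : exists E : set (K * K),
    [/\ closed E, forall x : K, nbhs (x, x) E, forall x y, E (x, y) -> E (y, x) &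
        E `<=` [set p | W (set_val p.1, set_val p.2)]].
  apply: exists_closed_symmetric_nbhs => // x.
  have [[A B] /= [nA nB] AB] := nW _ (set_valP x).
  exists (set_val @^-1` A, set_val @^-1` B).
    by split; apply/nbhs_subtypeP; [exists A|exists B].
  by move=> [y z] /= [Ay Bz]; exact: (AB (set_val y, set_val z)).
have expE x y : (forall j, E (iter j fX x, iter j fX y)) -> x = y.
  move=> xy; apply: val_inj; apply: expW; [exact: set_valP|exact: set_valP|].
  by move=> j; rewrite -!valX; exact: (EW _ (xy j)).
have unX := subtype_uncountable hunc.
split.
  have [p [m [w [N [m0 pm [u pu cu] wp nw]]]]] :=
    exists_homoclinic_point cX cfX openX clE nE symE expE unX.
  have vpm : iter m f (set_val p) = set_val p by rewrite -valX pm.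
  exists (cycle_set f (set_val p) m); split.
  - exists m, (set_val p); split=> //.
    exact: (periodic_repelling hf C0 lambda1 expf (set_valP p) m0 vpm).
  - exact: cycle_set_sub.
  - exists (fun z => match z with Posz i => set_val (u i)
                     | Negz j => iter j.+1 f (set_val w) end).
      move=> _ [[i|j] _ <-]; first exact: set_valP.
      by rewrite -valX; exact: set_valP.
    apply: (@homoclinic_of_unstable _ _ _ _ N).
    + exact: preorbit_subtype pu.
    + exact: converges_subtype cu.
    + move=> i Ni; rewrite -(subnK Ni) iterD -[iter N f _]valX wp.
      exact: cycle_set_iter.
    + by move/(cycle_set_subtype fK).
move=> [q Kq denseq] gamma [k [p [[k0 pk] gE]]] gK.
have Kp : K p by apply: gK; rewrite gE; exists 0%N.
pose pX : K := exist _ p (mem_set Kp); pose qX : K := exist _ q (mem_set Kq).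
have pXk : iter k fX pX = pX.
  have e : set_val (iter k fX pX) = set_val pX by rewrite valX.
  exact: val_inj e.
have dense (x : K) A : nbhs x A -> exists i, A (iter i fX qX).
  move=> /nbhs_subtypeP[V nV VA].
  have [_ [[[i _ <-] _] Vi]] := denseq _ (set_valP x) V nV.
  by exists i; apply: VA; rewrite /preimage /= valX.
have sub : K `<=` closure (iterated_preimages f gamma `&` unstable_set f gamma `&` K).
  move=> x Kx A nA; pose xX : K := exist _ x (mem_set Kx).
  have nX : nbhs xX (set_val @^-1` A) by apply/nbhs_subtypeP; exists A.
  have [w [N [Aw Ww wp]]] := dense_orbit_homoclinic cX cfX openX clE nE symE
    expE dense unX k0 pXk nX.
  exists (set_val w); split => //; split; last exact: set_valP.
  split; last by rewrite gE; exact: unstable_set_subtype Ww.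
  exists N => //; rewrite /preimage /= -valX wp gE; exists 0%N => //.
split; last by apply: subset_trans sub _; apply: closureS => x [].
apply/seteqP; split => // x.
have clK : closed K by apply: compact_closed => //; exact: manifold_hausdorff.
by move=> /(closureS (@subIsetr _ _ K)); rewrite -(closure_id _).1.
Qed.
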